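(* Let $k$ be a field of characteristic zero, $R = k[[x_1,\ldots,x_n]]$ with maximal ideal $\mathfrak{m}$, and $W\in\mathfrak{m}^2$ a polynomial such that $J_W = R/(\partial_{x_1}W,\ldots,\partial_{x_n}W)$ is finite-dimensional over $k$. Let $(X,d_X),(Y,d_Y)$ be finite rank matrix factorisations of $W$ over $R$ with fixed homogeneous bases, and $\alpha: X\to X$, $\beta: Y\to Y$ morphisms. Then $\mathrm{Hom}(\alpha,\beta): \mathrm{Hom}_R(X,Y)\to\mathrm{Hom}_R(X,Y)$ induces a degree zero map of finite-dimensional $\mathbb{Z}/2$-graded vector spaces $H_{\alpha,\beta}: H(\mathrm{Hom}_R(X,Y))\to H(\mathrm{Hom}_R(X,Y))$, and \[ \mathrm{str}_k(H_{\alpha,\beta}) = (-1)^{\binom{n}{2}}\mathrm{Res}\begin{bmatrix}\mathrm{str}_R\big(\alpha\,\partial_{x_1}(d_X)\cdots\partial_{x_n}(d_X)\big)\cdot\mathrm{str}_R\big(\beta\,\partial_{x_1}(d_Y)\cdots\partial_{x_n}(d_Y)\big)\cdot\mathrm{d}x_1\wedge\cdots\wedge\mathrm{d}x_n\\ \partial_{x_1}W,\ldots,\partial_{x_n}W\end{bmatrix}. \]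
   Context: A finite rank matrix factorisation of $W$ over $R$ is a $\mathbb{Z}/2$-graded free finite rank $R$-module $X$ with odd $d_X$, $d_X^2=W\cdot 1$; morphisms are even maps commuting with differentials. $\mathrm{Hom}_R(X,Y)$ is $\mathbb{Z}/2$-graded with differential $f\mapsto d_Yf-(-1)^{|f|}fd_X$ (squaring to zero), $\mathrm{Hom}(\alpha,\beta)(f) = \beta\circ f\circ\alpha$, and $H = H^0\oplus H^1$ denotes total cohomology. $\partial_{x_i}(d_X)$ is the entrywise partial derivative of the matrix of $d_X$ in the chosen basis. $\mathrm{str}$ is the supertrace (trace composed with the grading operator $x\mapsto(-1)^{|x|}x$). $\mathrm{Res}[\,\cdot\,/\,\partial_{x_1}W,\ldots,\partial_{x_n}W]$ is the Grothendieck local residue symbol of $R$ relative to $k$ (for $k=\mathbb{C}$ the analytic local residue at the origin). *)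

(* Defs.v *)
From mathcomp Require Import all_boot all_order all_algebra all_fingroup.
From Stdlib Require Import ClassicalEpsilon.
Set Implicit Arguments. Unset Strict Implicit. Unset Printing Implicit Defensive.
Import GRing.Theory.
Local Open Scope ring_scope.

Section PowerSeries.
Variables (k : fieldType) (n : nat).

Definition mono := {ffun 'I_n -> nat}.
Definition ps := mono -> k.

Definition mdeg (m : mono) : nat := (\sum_i m i)%N.
Definition mono0 : mono := [ffun _ => 0%N].
Definition monoc (N : nat) : mono := [ffun _ => N].
Definition monoX (i : 'I_n) (N : nat) : mono := [ffun j => if j == i then N else 0%N].
Definition mono_inc (m : mono) (i : 'I_n) : mono := [ffun j => (m j + (j == i))%N].

Definition pszero : ps := fun _ => 0.
Definition psone : ps := fun m => if m == mono0 then 1 else 0.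
Definition psadd (f g : ps) : ps := fun m => f m + g m.
Definition psmul (f g : ps) : ps := fun m =>
  \sum_(a : {ffun 'I_n -> 'I_(mdeg m).+1} | [forall i, (a i <= m i)%N])
     f [ffun i => nat_of_ord (a i)] * g [ffun i => (m i - a i)%N].
Definition psX (i : 'I_n) (N : nat) : ps :=
  fun m => if m == monoX i N then 1 else 0.
Definition psdiff (i : 'I_n) (f : ps) : ps :=
  fun m => (m i).+1%:R * f (mono_inc m i).

Definition is_poly (f : ps) := exists B : nat, forall m, (B <= mdeg m)%N -> f m = 0.
Definition in_msq (f : ps) := forall m, (mdeg m < 2)%N -> f m = 0.

Definition in_ideal (f : 'I_n -> ps) (h : ps) :=
  exists a : 'I_n -> ps, forall m, h m = \sum_i psmul (a i) (f i) m.
Definition fin_quot (f : 'I_n -> ps) :=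
  exists (N : nat) (g : 'I_N -> ps), forall h : ps,
    exists c : 'I_N -> k, in_ideal f (fun m => h m - \sum_j c j * g j m).

Definition mxmul a b c (A : 'M[ps]_(a, b)) (B : 'M[ps]_(b, c)) : 'M[ps]_(a, c) :=
  \matrix_(i, j) (fun m => \sum_l psmul (A i l) (B l j) m).
Definition mxsub a b (A B : 'M[ps]_(a, b)) : 'M[ps]_(a, b) :=
  \matrix_(i, j) (fun m => A i j m - B i j m).
Definition lincomb a b N (c : 'I_N -> k) (z : 'I_N -> 'M[ps]_(a, b)) : 'M[ps]_(a, b) :=
  \matrix_(i, j) (fun m => \sum_l c l * z l i j m).
Definition mxdiff a b (i : 'I_n) (A : 'M[ps]_(a, b)) : 'M[ps]_(a, b) :=
  \matrix_(p, q) psdiff i (A p q).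

Definition sgnb (p : bool) : k := (-1) ^+ p.

(* A free Z/2-graded module of rank r with a fixed homogeneous basis is
   given by the parity function g : 'I_r -> bool of the basis vectors
   (false = even, true = odd).  A map f : R^r -> R^s (matrix 'M_(s,r)) is
   homogeneous of degree p iff entries between basis vectors whose degrees
   differ by something other than p vanish. *)
Definition homog r s (gX : 'I_r -> bool) (gY : 'I_s -> bool) (p : bool)
    (f : 'M[ps]_(s, r)) :=
  forall i j m, gY i (+) gX j != p -> f i j m = 0.

Definition is_mf r (gX : 'I_r -> bool) (W : ps) (dX : 'M[ps]_r) :=
  homog gX gX true dX /\
  forall i j m, mxmul dX dX i j m = (if i == j then W m else 0).
Definition is_mf_morph r (gX : 'I_r -> bool) (dX a : 'M[ps]_r) :=
  homog gX gX false a /\ forall i j m, mxmul a dX i j m = mxmul dX a i j m.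

Section HomComplex.
Variables (r s : nat) (gX : 'I_r -> bool) (gY : 'I_s -> bool)
  (dX : 'M[ps]_r) (dY : 'M[ps]_s).

Definition Dhom (p : bool) (f : 'M[ps]_(s, r)) : 'M[ps]_(s, r) :=
  \matrix_(i, j) (fun m => mxmul dY f i j m - sgnb p * mxmul f dX i j m).

Definition cocycle (p : bool) (f : 'M[ps]_(s, r)) :=
  homog gX gY p f /\ forall i j m, Dhom p f i j m = 0.
Definition coboundary (p : bool) (f : 'M[ps]_(s, r)) :=
  exists g, homog gX gY (~~ p) g /\ forall i j m, f i j m = Dhom (~~ p) g i j m.

Definition Hbasis (p : bool) N (z : 'I_N -> 'M[ps]_(s, r)) :=
  [/\ forall l, cocycle p (z l),
      forall f, cocycle p f -> exists c : 'I_N -> k,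
        coboundary p (mxsub f (lincomb c z))
    & forall c : 'I_N -> k, coboundary p (lincomb c z) -> forall l, c l = 0].

Definition Hrep (phi : 'M[ps]_(s, r) -> 'M[ps]_(s, r)) (p : bool) N
    (z : 'I_N -> 'M[ps]_(s, r)) (M : 'M[k]_N) :=
  forall l, coboundary p (mxsub (phi (z l)) (lincomb (fun l' => M l l') z)).

End HomComplex.

Definition pstr r (gX : 'I_r -> bool) (A : 'M[ps]_r) : ps :=
  fun m => \sum_i sgnb (gX i) * A i i m.
Definition KLprod r (a dX : 'M[ps]_r) : 'M[ps]_r :=
  foldl (fun acc i => mxmul acc (mxdiff i dX)) a (enum 'I_n).

Definition psdet (A : 'M[ps]_n) : ps :=
  fun m => \sum_(sg : 'S_n) (-1) ^+ sg * (\big[psmul/psone]_(i < n) A i (sg i)) m.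

(* Grothendieck residue symbol Res[h dx_1 ^ ... ^ dx_n / f_1,...,f_n],
   characterised by the transformation law and the normalisation
   Res[h dx / x_1^N,...,x_n^N] = coefficient of x^(N-1,...,N-1) in h:
   if x_i^N = \sum_j A_ij f_j then Res[h dx / f] = coeff_(N-1) (h det A). *)
Definition res_valid (f : 'I_n -> ps) (N : nat) (A : 'M[ps]_n) :=
  (0 < N)%N /\ forall i m, psX i N m = \sum_j psmul (A i j) (f j) m.
Definition res_value (h : ps) (N : nat) (A : 'M[ps]_n) : k :=
  psmul h (psdet A) (monoc N.-1).
Definition Res (f : 'I_n -> ps) (h : ps) : k :=
  epsilon (inhabits 0) (fun v => (exists N A, res_valid f N A) /\
    forall N A, res_valid f N A -> v = res_value h N A).

End PowerSeries.

(* Main.v *)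
(** Choose [x_i^N = sum_j A_ij d_j W].  On [Z = Hom(X, Y)], left multiplication by
    [d_j(d_Y)] is a null-homotopy of [d_j W], so [L_i = sum_j A_ij d_j(d_Y)] is a
    null-homotopy of [x_i^N].  Let [S_i] be the k-linear division by [x_i^N] (monomials
    not divisible by [x_i^N] go to 0).  Then [S_i L_i] is a homotopy from the identity
    to [- [D, S_i] L_i], and iterating over the variables the map [Phi = Hom(alpha, beta)]
    is homotopic to [(-1)^n Phi [D, S_1] ... [D, S_n] L_n ... L_1], which kills all
    [x_i^N Z] and so has finite rank over [k]: its supertrace on [Z/(x_1^N, ..., x_n^N)]
    is the supertrace on cohomology.  One variable at a time, the trace of [T [D, S_i]]
    is minus the coefficient of [x_i^(N-1)] in the trace of [T d_i D], which leaves the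
    coefficient of [(x_1 ... x_n)^(N-1)] in
    [str_R (Phi d_1 D ... d_n D L_n ... L_1)].

    The same homotopies on the Koszul complex show that the traces of words of length
    [< n] in the [d_i(d_X)] lie in the ideal of the [d_i W], and that those of length [n]
    alternate modulo it.  Hence [L_n ... L_1] may be replaced by [det A] times a word in
    the [d_j(d_Y)], which is where the residue comes from, and in the expansion of
    [d_i D] into its [Y] and [X] parts only the term with all [n] factors from [X]
    survives. *)
Require Import Defs.
From HB Require Import structures.
From mathcomp Require Import all_boot all_order all_algebra all_fingroup.
From mathcomp Require Import boolp zify.
From Stdlib Require Import ClassicalEpsilon.
Set Implicit Arguments. Unset Strict Implicit. Unset Printing Implicit Defensive.
Import GRing.Theory.
Local Open Scope ring_scope.

(** * The ring of power series *)

(** In general the truncation of [Z] modulo the [x_i^N] has larger cohomology than [Z], and lifting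
    truncated vectors to polynomial ones is not a chain map; the traces are compared through the
    lift followed by the finite rank operator, which is one. A second obstacle is that the
    derivatives of a differential need not anticommute: only the traces of their words of length [n]
    do, and only modulo an ideal. The Koszul complex is therefore taken on all words in the indices,
    and the determinant is extracted by averaging over the [n!] orders, which uses characteristic
    zero. The sign [(-1)^|f|] of the Hom differential is carried by grading matrices; collecting
    those of [n] factors on one side gives [(-1)^C(n,2)]. For odd [n] both sides of the formula
    vanish, because odd matrices have trace zero. Matrices act on row vectors from the right, which
    reverses words of operators. *)

Section Monomials.
Variable n : nat.
Implicit Types (a b c m u : mono n) (i j : 'I_n).

Definition madd a b : mono n := [ffun i => (a i + b i)%N].
Definition msub a b : mono n := [ffun i => (a i - b i)%N].
Definition mle a b := [forall i, (a i <= b i)%N].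
(** The index set of the sum in [psmul] as a duplicate-free list, so that products can be reindexed
    by permutations of lists. *)
Definition below m : seq (mono n) :=
  map (fun x : {ffun 'I_n -> 'I_(mdeg m).+1} => [ffun i => nat_of_ord (x i)])
    (filter (fun x : {ffun 'I_n -> 'I_(mdeg m).+1} => [forall i, (x i <= m i)%N])
      (enum {: {ffun 'I_n -> 'I_(mdeg m).+1}})).

Lemma monoP a b : (forall i, a i = b i :> nat) -> a = b.
Proof. by move=> e; apply/ffunP. Qed.

Lemma mleP a b : reflect (forall i, (a i <= b i)%N) (mle a b).
Proof. exact: forallP. Qed.

Lemma leq_mdeg m i : (m i <= mdeg m)%N.
Proof. by rewrite /mdeg (bigD1 i) //= leq_addr. Qed.

Lemma mdeg_add a b : mdeg (madd a b) = (mdeg a + mdeg b)%N.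
Proof. by rewrite /mdeg -big_split; apply: eq_bigr => i _; rewrite ffunE. Qed.

Lemma maddC a b : madd a b = madd b a.
Proof. by apply/ffunP => i; rewrite !ffunE addnC. Qed.

Lemma maddA a b c : madd a (madd b c) = madd (madd a b) c.
Proof. by apply/ffunP => i; rewrite !ffunE addnA. Qed.

Lemma madd0 a : madd a (mono0 n) = a.
Proof. by apply/ffunP => i; rewrite !ffunE addn0. Qed.

Lemma maddK a b : msub (madd a b) b = a.
Proof. by apply/ffunP => i; rewrite !ffunE addnK. Qed.

Lemma msubK a b : mle b a -> madd b (msub a b) = a.
Proof. by move/mleP => ba; apply/ffunP => i; rewrite !ffunE subnKC. Qed.

Lemma mle_addr a b : mle a (madd a b).
Proof. by apply/mleP => i; rewrite ffunE leq_addr. Qed.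

Lemma mle_trans a b c : mle a b -> mle b c -> mle a c.
Proof. by move=> /mleP ab /mleP bc; apply/mleP => i; apply: leq_trans (ab i) (bc i). Qed.

Lemma mem_below a m : (a \in below m) = mle a m.
Proof.
apply/mapP/mleP => [[x] | le_am].
  by rewrite mem_filter => /andP[/forallP le_xm _] -> i; rewrite ffunE.
have lt_am i : (a i < (mdeg m).+1)%N by rewrite ltnS (leq_trans (le_am i)) ?leq_mdeg.
exists [ffun i => Ordinal (lt_am i)].
  rewrite mem_filter mem_enum inE andbT.
  by apply/forallP => i; rewrite ffunE /= le_am.
by apply/ffunP => i; rewrite !ffunE.
Qed.

Lemma below_uniq m : uniq (below m).
Proof.
rewrite map_inj_in_uniq => [|x y _ _ /ffunP exy].
  exact: filter_uniq (enum_uniq _).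
by apply/ffunP => i; apply/val_inj; have:= exy i; rewrite !ffunE.
Qed.

End Monomials.

Section Ring.
Variables (k : fieldType) (n : nat).
Local Notation ps := (ps k n).
Implicit Types (a b c m u : mono n) (i j : 'I_n) (f g h : ps).

Lemma psmulE f g m : psmul f g m = \sum_(a <- below m) f a * g (msub m a).
Proof.
rewrite /psmul /below big_map big_filter big_enum_cond /=.
apply: eq_bigr => x _; congr (_ * g _).
by apply/ffunP => i; rewrite !ffunE.
Qed.

Lemma sum_below_sub m (F : mono n -> k) :
  \sum_(a <- below m) F a = \sum_(a <- below m) F (msub m a).
Proof.
rewrite -[RHS](big_map (msub m) xpredT F); apply: perm_big; apply: uniq_perm.
- exact: below_uniq.
- rewrite map_inj_in_uniq ?below_uniq // => x y.
  rewrite !mem_below => /mleP lx /mleP ly exy; apply: monoP => i.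
  have:= congr1 (fun z : mono n => z i) exy; have:= lx i; have:= ly i.
  by rewrite !ffunE; lia.
move=> x; apply/idP/mapP => [|[y]].
  rewrite mem_below => /mleP lx; exists (msub m x).
    by rewrite mem_below; apply/mleP => i; rewrite ffunE leq_subr.
  by apply: monoP => i; have:= lx i; rewrite !ffunE; lia.
by rewrite !mem_below => _ ->; apply/mleP => i; rewrite ffunE leq_subr.
Qed.

Lemma sum_below_le b m (F : mono n -> k) : mle b m ->
  \sum_(a <- below m | mle b a) F a = \sum_(c <- below (msub m b)) F (madd b c).
Proof.
move=> /mleP lbm; rewrite -big_filter -[RHS](big_map (madd b) xpredT F).
apply: perm_big; apply: uniq_perm.
- by rewrite filter_uniq ?below_uniq.
- rewrite map_inj_in_uniq ?below_uniq // => x y _ _ exy; apply: monoP => i.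
  by have:= congr1 (fun z : mono n => z i) exy; rewrite !ffunE; lia.
move=> x; rewrite mem_filter mem_below; apply/andP/mapP => [[lbx /mleP lxm]|[y]].
  exists (msub x b); last by rewrite msubK.
  rewrite mem_below; apply/mleP => i; have:= lxm i; move/mleP: lbx => /(_ i).
  by rewrite !ffunE; lia.
rewrite mem_below => /mleP ly ->; rewrite mle_addr; split=> //; apply/mleP => i.
by have:= ly i; have:= lbm i; rewrite !ffunE; lia.
Qed.

Lemma sum_below_ge a m (F : mono n -> k) : mle a m ->
  \sum_(b <- below a) F b = \sum_(b <- below m | mle b a) F b.
Proof.
move=> lam; rewrite -[RHS]big_filter; apply: perm_big; apply: uniq_perm.
- exact: below_uniq.
- by rewrite filter_uniq ?below_uniq.
move=> x; rewrite mem_filter !mem_below; case lxa: (mle x a) => //=.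
by rewrite (mle_trans lxa lam).
Qed.

Lemma psaddA : associative (@psadd k n).
Proof. by move=> f g h; apply/funext => m; rewrite /psadd addrA. Qed.
Lemma psaddC : commutative (@psadd k n).
Proof. by move=> f g; apply/funext => m; rewrite /psadd addrC. Qed.
Lemma psadd0 : left_id (@pszero k n) (@psadd k n).
Proof. by move=> f; apply/funext => m; rewrite /psadd add0r. Qed.
Definition psopp f : ps := fun m => - f m.
Lemma psaddN : left_inverse (@pszero k n) psopp (@psadd k n).
Proof. by move=> f; apply/funext => m; rewrite /psadd /psopp addNr. Qed.

Lemma psmulC : commutative (@psmul k n).
Proof.
move=> f g; apply/funext => m; rewrite !psmulE sum_below_sub.
apply: eq_big_seq => a; rewrite mem_below => /mleP lam.
rewrite mulrC; congr (g _ * _); apply: monoP => i.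
by have:= lam i; rewrite !ffunE; lia.
Qed.

Lemma psmulA : associative (@psmul k n).
Proof.
move=> f g h; apply/funext => m; rewrite !psmulE; symmetry.
transitivity (\sum_(a <- below m) \sum_(b <- below m | mle b a)
    f b * g (msub a b) * h (msub m a)).
  apply: eq_big_seq => a; rewrite mem_below => lam.
  by rewrite psmulE (sum_below_ge _ lam) mulr_suml.
rewrite (exchange_big_dep xpredT) //=.
apply: eq_big_seq => b; rewrite mem_below => lbm.
rewrite (sum_below_le (fun a => f b * g (msub a b) * h (msub m a)) lbm).
rewrite psmulE mulr_sumr; apply: eq_bigr => c _; rewrite mulrA.
congr (_ * g _ * h _); first by rewrite maddC maddK.
by apply/ffunP => i; rewrite !ffunE subnDA.
Qed.

Definition mon u : ps := fun m => if m == u then 1 else 0.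

Lemma psmul_mon u f m : psmul (mon u) f m = if mle u m then f (msub m u) else 0.
Proof.
rewrite psmulE /mon; case: ifPn => [lum | nlum].
  rewrite (bigD1_seq u) ?mem_below ?below_uniq //= eqxx mul1r.
  by rewrite big1 ?addr0 // => a /negPf ->; rewrite mul0r.
rewrite big1_seq // => a /andP[_]; rewrite mem_below; case: eqP => [->|]; last by rewrite mul0r.
by rewrite (negPf nlum).
Qed.

Lemma psmul1 : left_id (@psone k n) (@psmul k n).
Proof.
move=> f; apply/funext => m; rewrite -[@psone k n]/(mon (mono0 n)) psmul_mon.
have -> : mle (mono0 n) m by apply/mleP => i; rewrite ffunE.
by congr f; apply/ffunP => i; rewrite !ffunE subn0.
Qed.

Lemma psmulDl : left_distributive (@psmul k n) (@psadd k n).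
Proof.
move=> f g h; apply/funext => m; rewrite /psadd !psmulE -big_split /=.
by apply: eq_bigr => a _; rewrite mulrDl.
Qed.

Lemma psone_neq0 : @psone k n <> @pszero k n.
Proof.
move=> /(congr1 (fun f : ps => f (mono0 n))); rewrite /psone /pszero eqxx.
exact/eqP/oner_neq0.
Qed.

End Ring.

HB.instance Definition _ (k : fieldType) (n : nat) := gen_eqMixin (ps k n).
HB.instance Definition _ (k : fieldType) (n : nat) := gen_choiceMixin (ps k n).
HB.instance Definition _ (k : fieldType) (n : nat) :=
  GRing.isZmodule.Build (ps k n) (@psaddA k n) (@psaddC k n) (@psadd0 k n) (@psaddN k n).
HB.instance Definition _ (k : fieldType) (n : nat) :=
  GRing.Zmodule_isComNzRing.Build (ps k n) (@psmulA k n) (@psmulC k n) (@psmul1 k n)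
    (@psmulDl k n) (introN eqP (@psone_neq0 k n)).

Section Coef.
Variables (k : fieldType) (n : nat).
Local Notation ps := (ps k n).
Implicit Types (a b c m u : mono n) (i j : 'I_n) (f g h : ps).

(** A named coefficient map can carry an additive structure, so that the [raddf] lemmas apply to
    it. *)
Definition cf m f : k := f m.

Lemma cf_is_additive m : {morph cf m : f g / f - g}.
Proof. by []. Qed.
HB.instance Definition _ m := GRing.isZmodMorphism.Build ps k (cf m) (cf_is_additive m).

Lemma psP f g : (forall m, cf m f = cf m g) -> f = g.
Proof. by move=> e; apply/funext. Qed.

Lemma cf_mon u m : cf m (mon k u) = (m == u)%:R.
Proof. by rewrite /cf /mon; case: eqP. Qed.

Lemma cf_mon_mul u f m : cf m (mon k u * f) = if mle u m then cf (msub m u) f else 0.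
Proof. exact: psmul_mon. Qed.

Lemma cf_mul f g m : cf m (f * g) = \sum_(a <- below m) cf a f * cf (msub m a) g.
Proof. exact: psmulE. Qed.

Lemma psX_mon i N : psX k i N = mon k (monoX i N). Proof. by []. Qed.

Definition psC (c : k) : ps := fun m => if m == mono0 n then c else 0.

Lemma cf_psC (c : k) m : cf m (psC c) = if m == mono0 n then c else 0.
Proof. by []. Qed.

Lemma cf_psC_mul (c : k) f m : cf m (psC c * f) = c * cf m f.
Proof.
have m0 : mle (mono0 n) m by apply/mleP => i; rewrite ffunE.
rewrite cf_mul (bigD1_seq (mono0 n)) ?mem_below ?below_uniq //= cf_psC eqxx.
rewrite big1 ?addr0 => [|a /negPf na]; last by rewrite cf_psC na mul0r.
by congr (c * cf _ f); apply: monoP => i; rewrite !ffunE subn0.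
Qed.

Lemma psC_is_zmod : zmod_morphism psC.
Proof. by move=> x y; apply: psP => m; rewrite raddfB /= !cf_psC; case: eqP; rewrite ?subr0. Qed.
Lemma psC_is_monoid : monoid_morphism psC.
Proof.
by split=> [|x y]; apply: psP => m //; rewrite cf_psC_mul !cf_psC; case: eqP; rewrite ?mulr0.
Qed.
HB.instance Definition _ := GRing.isZmodMorphism.Build k ps psC psC_is_zmod.
HB.instance Definition _ := GRing.isMonoidMorphism.Build k ps psC psC_is_monoid.

Lemma psC_sign e : (-1) ^+ e = psC ((-1) ^+ e) :> ps.
Proof. by rewrite rmorphXn rmorphN1. Qed.

Lemma monD a b : mon k (madd a b) = mon k a * mon k b.
Proof.
apply: psP => m; rewrite cf_mon_mul !cf_mon; case: ifP => [lam | nlam].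
  congr (_%:R); congr nat_of_bool; apply/eqP/eqP => [->|<-].
    by rewrite maddC maddK.
  by rewrite msubK.
by case: eqP => // em; rewrite em mle_addr in nlam.
Qed.

Lemma mon0 : mon k (mono0 n) = 1. Proof. by []. Qed.

End Coef.

(** * Division by a power of one variable, and partial derivatives *)

Section Shift.
Variables (k : fieldType) (n : nat).
Local Notation ps := (ps k n).
Implicit Types (a b c m : mono n) (i j : 'I_n) (f g h : ps) (N e u : nat).

Lemma monoX_D i e e' : monoX i (e + e') = madd (monoX i e) (monoX i e').
Proof. by apply: monoP => j; rewrite !ffunE; case: eqP. Qed.

Lemma monoX0 i : monoX i 0 = mono0 n.
Proof. by apply: monoP => j; rewrite !ffunE; case: eqP. Qed.

Lemma mle_monoX i e m : mle (monoX i e) m = (e <= m i)%N.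
Proof.
apply/mleP/idP => [/(_ i)|le_e j]; rewrite ffunE ?eqxx //.
by case: eqP => // ->.
Qed.

Lemma psX_D i e e' : psX k i (e + e') = psX k i e * psX k i e'.
Proof. by rewrite !psX_mon monoX_D monD. Qed.

Lemma psX0 i : psX k i 0 = 1.
Proof. by rewrite psX_mon monoX0. Qed.

Lemma cf_psX_mul i e f m :
  cf m (psX k i e * f) = if (e <= m i)%N then cf (msub m (monoX i e)) f else 0.
Proof. by rewrite psX_mon cf_mon_mul mle_monoX. Qed.

Lemma cf_psX_mulD i e f m : cf (madd m (monoX i e)) (psX k i e * f) = cf m f.
Proof. by rewrite cf_psX_mul !ffunE eqxx leq_addl maddK. Qed.

Lemma psX_inj i e f g : psX k i e * f = psX k i e * g -> f = g.
Proof. by move=> efg; apply: psP => m; rewrite -(cf_psX_mulD i e) efg cf_psX_mulD. Qed.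

Definition shift i N f : ps := fun m => f (madd m (monoX i N)).

Lemma cf_shift i N f m : cf m (shift i N f) = cf (madd m (monoX i N)) f.
Proof. by []. Qed.

Lemma shift_is_zmod i N : zmod_morphism (shift i N).
Proof. by []. Qed.
HB.instance Definition _ i N := GRing.isZmodMorphism.Build ps ps (shift i N) (shift_is_zmod i N).

Lemma shift_psX i N f : shift i N (psX k i N * f) = f.
Proof. by apply: psP => m; rewrite cf_shift cf_psX_mulD. Qed.

(** Series without [x_i]: [shift i N], though not linear over the whole ring, is linear over
    these. *)
Definition free_of i f := forall m, (0 < m i)%N -> cf m f = 0.

Lemma shift_free i N g f : free_of i g -> shift i N (g * f) = g * shift i N f.
Proof.
move=> gi; apply: psP => m; rewrite cf_shift !cf_mul.
rewrite (sum_below_ge _ (mle_addr m (monoX i N))) [RHS]big_mkcond.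
apply: eq_big_seq => a; rewrite mem_below => /mleP lea; case: ifPn => [/mleP lam|nlam].
  rewrite cf_shift; congr (_ * cf _ f); apply: monoP => j.
  by have:= lam j; rewrite !ffunE; lia.
case: (posnP (a i)) => [ai0|/gi ->]; last by rewrite mul0r.
case/mleP: nlam => j; have:= lea j; rewrite !ffunE; case: eqP => [->|_]; rewrite ?ai0 //.
by rewrite addn0.
Qed.

Lemma free_psX i j e : i != j -> free_of i (psX k j e).
Proof.
move=> /negPf ij m mi; rewrite psX_mon cf_mon; case: eqP => // em.
by rewrite em ffunE ij in mi.
Qed.

Lemma shift_psX_ne i j N e f : i != j ->
  shift i N (psX k j e * f) = psX k j e * shift i N f.
Proof. by move=> ij; apply: shift_free; apply: free_psX. Qed.

(** The coefficient of [x_i^e] when [f] is read as a series in [x_i] over the series free of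
    [x_i]. *)
Definition slice i e f : ps := fun m => if m i == 0%N then f (madd m (monoX i e)) else 0.

Lemma free_slice i e f : free_of i (slice i e f).
Proof. by move=> m; rewrite lt0n /cf /slice => /negPf ->. Qed.

Lemma slice_sum i e f :
  f = \sum_(u < e) psX k i u * slice i u f + psX k i e * shift i e f.
Proof.
apply: psP => m; rewrite raddfD raddf_sum /= cf_psX_mul.
have mE u : (u <= m i)%N -> madd (msub m (monoX i u)) (monoX i u) = m.
  by move=> lu; rewrite maddC msubK // mle_monoX.
case: ifPn => [lem|]; rewrite ?cf_shift ?mE //.
  rewrite big1 ?add0r // => u _; rewrite cf_psX_mul; case: ifP => // lu.
  rewrite /cf /slice !ffunE eqxx subn_eq0 leqNgt.
  by rewrite (leq_trans (ltn_ord u) lem).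
rewrite -ltnNge => lem; rewrite addr0 (bigD1 (Ordinal lem)) //= cf_psX_mul leqnn.
rewrite big1 ?addr0 => [|u /eqP nu]; rewrite ?cf_psX_mul.
  by rewrite /cf /slice !ffunE eqxx subnn eqxx mE.
case: ifP => // lu; rewrite /cf /slice !ffunE eqxx subn_eq0 leqNgt.
suff -> : (u < m i)%N by [].
by rewrite ltn_neqAle lu andbT; apply/eqP => eu; case: nu; apply/val_inj.
Qed.

Lemma shift_slice i N e u f : (e < N)%N -> shift i N (psX k i e * slice i u f) = 0.
Proof.
move=> eN; apply: psP => m; rewrite cf_shift cf_psX_mul raddf0 /=; case: ifP => // _.
by rewrite free_slice // !ffunE !eqxx; lia.
Qed.

(** The operator [x_i d/dx_i]. It weights coefficients by the exponent of [x_i], which is additive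
    in products, so the Leibniz rule is checked here and carried to [psdiff] by cancelling [x_i]. *)
Definition euler i f : ps := fun m => (m i)%:R * f m.

Lemma cf_euler i f m : cf m (euler i f) = (m i)%:R * cf m f. Proof. by []. Qed.

Lemma euler_mul i f g : euler i (f * g) = euler i f * g + f * euler i g.
Proof.
apply: psP => m; rewrite cf_euler raddfD /= !cf_mul mulr_sumr -big_split /=.
apply: eq_big_seq => a; rewrite mem_below => /mleP /(_ i) lam.
rewrite !cf_euler; have -> : (m i)%:R = (a i)%:R + (msub m a i)%:R :> k.
  by rewrite -natrD ffunE subnKC.
by rewrite mulrDl; congr (_ + _); [rewrite mulrA | rewrite mulrCA].
Qed.

Lemma cf_psdiff i f m : cf m (psdiff i f) = (m i).+1%:R * cf (madd m (monoX i 1)) f.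
Proof.
rewrite /cf /psdiff; congr (_ * f _); apply: monoP => j; rewrite !ffunE.
by case: eqP.
Qed.

Lemma euler_psdiff i f : euler i f = psX k i 1 * psdiff i f.
Proof.
apply: psP => m; rewrite cf_euler cf_psX_mul cf_psdiff; case: ifPn => [lm|].
  by rewrite maddC msubK ?mle_monoX // !ffunE eqxx subn1 prednK.
by rewrite -leqNgt leqn0 => /eqP ->; rewrite mul0r.
Qed.

Lemma psdiff_is_zmod i : zmod_morphism (@psdiff k n i).
Proof. by move=> f g; apply: psP => m; rewrite raddfB /= !cf_psdiff raddfB mulrBr. Qed.
HB.instance Definition _ i := GRing.isZmodMorphism.Build ps ps (@psdiff k n i) (psdiff_is_zmod i).

Lemma psdiffM i f g : psdiff i (f * g) = psdiff i f * g + f * psdiff i g.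
Proof.
apply: (@psX_inj i 1); rewrite -euler_psdiff euler_mul !euler_psdiff mulrDr.
by congr (_ + _); [rewrite mulrA | rewrite mulrCA].
Qed.

Lemma psdiff_psX i e : psdiff i (psX k i e) = psX k i e.-1 *+ e.
Proof.
apply: (@psX_inj i 1); rewrite -euler_psdiff mulrnAr -psX_D.
apply: psP => m; rewrite cf_euler raddfMn /= !psX_mon !cf_mon.
case: e => [|e]; rewrite ?mulr0n.
  by case: eqP => [->|]; rewrite ?mulr0 // !ffunE eqxx mul0r.
rewrite add1n; case: eqP => [->|]; rewrite ?mulr0 ?mul0rn //.
by rewrite !ffunE eqxx mulr1.
Qed.

Lemma psdiff_slice i e f : psdiff i (slice i e f) = 0.
Proof.
apply: psP => m; rewrite cf_psdiff (free_slice (i := i)) ?mulr0 //.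
by rewrite !ffunE eqxx addn1.
Qed.

Lemma psdiffC (c : k) i : psdiff i (psC c) = 0.
Proof.
apply: psP => m; rewrite cf_psdiff cf_psC; case: eqP; rewrite ?mulr0 //.
by move=> /(congr1 (fun z : mono n => z i)); rewrite !ffunE eqxx addn1.
Qed.

End Shift.

(** The condition cuts out [N - u - b <= c < N - b], which is [u] indices; this count becomes the
    factor [u] in the derivative of [x_i^u]. *)
Lemma sum_nat_interval (N b u : nat) : (u + b <= N)%N ->
  (\sum_(c < N) ((c + b < N) && (N <= c + u + b)) = u)%N.
Proof.
move=> le_ub; rewrite -(big_mkord xpredT (fun c => nat_of_bool ((c + b < N) && (N <= c + u + b))%N)).
rewrite (@big_cat_nat _ _ _ (N - (u + b))%N) //=; last by lia.
rewrite [X in (_ + X)%N](@big_cat_nat _ _ _ (N - b)%N) //=; try by lia.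
rewrite big_nat big1 ?add0n; last by move=> c /andP[_ lc]; apply/eqP; lia.
rewrite [X in (_ + X)%N]big_nat [X in (_ + X)%N]big1 ?addn0;
  last by move=> c /andP[lc _]; apply/eqP; lia.
rewrite big_nat (eq_bigr (fun=> 1%N)); last by move=> c /andP[l1 l2]; apply/eqP; lia.
by rewrite -big_nat sum_nat_const_nat muln1; lia.
Qed.

(** * The trace of a commutator with division by a power of a variable *)

Section OneVariable.
Variables (k : fieldType) (n M : nat) (i : 'I_n) (N : nat).
Local Notation ps := (ps k n).
Local Notation X := (psX k i).

Definition shiftmx a b : 'M[ps]_(a, b) -> 'M[ps]_(a, b) := map_mx (shift i N).
HB.instance Definition _ a b := GRing.Additive.on (@shiftmx a b).

Definition free_mx a b (A : 'M[ps]_(a, b)) := forall p q, free_of i (A p q).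

Lemma slice_mx_sum a b e (A : 'M[ps]_(a, b)) :
  A = \sum_(u < e) X u *: map_mx (slice i u) A + X e *: map_mx (shift i e) A.
Proof.
apply/matrixP => p q; rewrite !mxE summxE {1}(slice_sum i e (A p q)).
by congr (_ + _); apply: eq_bigr => u _; rewrite !mxE.
Qed.

Lemma shiftmx_free a b c (A : 'M[ps]_(a, b)) (B : 'M[ps]_(b, c)) :
  free_mx B -> shiftmx (A *m B) = shiftmx A *m B.
Proof.
move=> Bi; apply/matrixP => p q; rewrite !mxE raddf_sum; apply: eq_bigr => l _.
by rewrite /= !mxE mulrC shift_free // mulrC.
Qed.

Lemma shiftmx_psX a b (A : 'M[ps]_(a, b)) : shiftmx (X N *: A) = A.
Proof. by apply/matrixP => p q; rewrite !mxE shift_psX. Qed.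

Lemma shiftmx_slice a b e u (A : 'M[ps]_(a, b)) :
  shiftmx (X e *: map_mx (slice i u) A) =
  if (e < N)%N then 0 else X (e - N) *: map_mx (slice i u) A.
Proof.
apply/matrixP => p q; rewrite !mxE; case: ltnP => eN; rewrite !mxE.
  by rewrite shift_slice.
by rewrite -{1}(subnKC eN) psX_D -mulrA shift_psX.
Qed.

(* [D] acts on row vectors, so [v *m D] is its value at [v]; the commutator with
   the k-linear division by [x_i^N] kills all multiples of [x_i^N]. *)
Definition comm_shift (D : 'M[ps]_M) (v : 'rV[ps]_M) : 'rV[ps]_M :=
  shiftmx v *m D - shiftmx (v *m D).

(** [F c] stands for the coefficient of [x_i^c] in one entry of [T v], where the operator [T]
    commutes with [x_i]; [FX] records that commutation. *)
Variable F : nat -> {additive 'rV[ps]_M -> k}.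
Hypothesis FX : forall c d v, F c (X d *: v) = if (d <= c)%N then F (c - d)%N v else 0.

(** The commutator of [x_i^u] with [S_i] at [x_i^c v]; it is what [comm_shift] becomes for a matrix
    [x_i^u B] with [B] free of [x_i]. *)
Definition comm_psX u c (v : 'rV[ps]_M) : 'rV[ps]_M :=
  X u *: shiftmx (X c *: v) - shiftmx (X (u + c) *: v).

Lemma comm_psX_is_zmod u c : zmod_morphism (comm_psX u c).
Proof.
move=> v w; rewrite /comm_psX !scalerBr !(raddfB (@shiftmx 1 M)) scalerBr !opprB /=.
by rewrite addrACA [RHS]addrACA [- shiftmx _ + _]addrC.
Qed.
HB.instance Definition _ u c :=
  GRing.isZmodMorphism.Build _ _ (comm_psX u c) (comm_psX_is_zmod u c).

Lemma comm_psX_high u c v : comm_psX u c (X N *: v) = 0.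
Proof.
rewrite /comm_psX !scalerA [X c * _]mulrC [X (u + c) * _]mulrC -!scalerA !shiftmx_psX.
by rewrite scalerA -psX_D subrr.
Qed.

(** On [v = x_i^b w] with [w] free of [x_i], the commutator is [- x_i^(u+c+b-N) w] when
    [c + b < N <= c + u + b] and zero otherwise. For [u + b <= N], applying [F c] gives
    [- F (N-u-b) w], independent of [c], and exactly [u] values of [c] contribute. *)
Lemma trace_comm_psX u (v : 'rV[ps]_M) : (u <= N)%N ->
  \sum_(c < N) F c (comm_psX u c v) = - (F (N - u)%N v *+ u).
Proof.
move=> uN; rewrite [in RHS](slice_mx_sum N v).
rewrite (raddfD (F (N - u)%N)) (raddf_sum (F (N - u)%N)) FX mulrnDl.
have -> : (if (N <= N - u)%N then F (N - u - N)%N (map_mx (shift i N) v) else 0) *+ u = 0.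
  by case: ifP => [lu|]; rewrite ?mul0rn //; have -> : u = 0%N by lia.
rewrite addr0 -sumrMnl -sumrN.
transitivity (\sum_(c < N) \sum_(b < N) F c (comm_psX u c (X b *: map_mx (slice i b) v))).
  apply: eq_bigr => c _; rewrite [in LHS](slice_mx_sum N v).
  rewrite (raddfD (comm_psX u c)) /= comm_psX_high addr0.
  by rewrite (raddf_sum (comm_psX u c)) /= (raddf_sum (F c)).
rewrite exchange_big; apply: eq_bigr => b _ /=.
have Fb c : F c (comm_psX u c (X b *: map_mx (slice i b) v)) =
   - (if (u + b <= N)%N then F (N - u - b)%N (map_mx (slice i b) v) else 0)
     *+ ((c + b < N) && (N <= c + u + b))%N.
  rewrite /comm_psX !scalerA -!psX_D !shiftmx_slice; case: ltnP => cb /=; last first.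
    have -> : (u + c + b < N)%N = false by lia.
    by rewrite scalerA -psX_D addnBA // addnA subrr raddf0 mulr0n.
  rewrite scaler0 sub0r raddfN /= (addnC c u); case: (ltnP (u + c + b)) => ucb.
    by rewrite raddf0 oppr0 mulr0n.
  rewrite mulr1n FX; congr (- _).
  have -> : (u + c + b - N <= c)%N = (u + b <= N)%N by lia.
  by case: leqP => // le; congr (F _ _); lia.
under eq_bigr => c _ do rewrite Fb.
rewrite sumrMnr FX.
have -> : (b <= N - u)%N = (u + b <= N)%N by lia.
case: leqP => ub; last by rewrite oppr0 !mul0rn oppr0.
by rewrite sum_nat_interval // mulNrn.
Qed.

(** Expand [D] in powers of [x_i]. Since [S_i] commutes with the coefficients [D_u], the term
    [x_i^u D_u] contributes [- u F (N-u) (v D_u)], and the [u x_i^(u-1) D_u] sum to the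
    derivative. *)
Lemma trace_comm_shift (D : 'M[ps]_M) (v : 'rV[ps]_M) : (0 < N)%N ->
  \sum_(c < N) F c (comm_shift D (X c *: v)) =
  - F N.-1 (v *m map_mx (psdiff i) D).
Proof.
move=> N0.
have comm0 c : F c (comm_shift (X N.+1 *: map_mx (shift i N.+1) D) (X c *: v)) = 
   F c (X N.+1 *: shiftmx (X c *: v) *m map_mx (shift i N.+1) D) -
   F c (X c.+1 *: v *m map_mx (shift i N.+1) D).
  rewrite /comm_shift raddfB /= -scalemxAr scalemxAl; congr (_ - F c _).
  rewrite -scalemxAr -[in LHS]scalemxAl scalerA mulrC -psX_D.
  have -> : (c + N.+1 = N + c.+1)%N by lia.
  by rewrite psX_D -scalerA shiftmx_psX scalemxAl.
have commE u c : comm_shift (X u *: map_mx (slice i u) D) (X c *: v) =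
    comm_psX u c (v *m map_mx (slice i u) D).
  have fr : free_mx (map_mx (slice i u) D) by move=> p q; rewrite mxE; apply: free_slice.
  rewrite /comm_shift -!scalemxAr -!scalemxAl -(shiftmx_free _ fr) -scalemxAl.
  by rewrite /comm_psX psX_D scalerA.
have commD A B w : comm_shift (A + B) w = comm_shift A w + comm_shift B w.
  by rewrite /comm_shift !mulmxDr raddfD /= opprD addrACA.
have comm_sum I r (A : I -> 'M[ps]_M) w :
    comm_shift (\sum_(l <- r) A l) w = \sum_(l <- r) comm_shift (A l) w.
  elim: r => [|l r IH]; last by rewrite !big_cons commD IH.
  by rewrite !big_nil /comm_shift !mulmx0 raddf0 subr0.
(* The expansion runs up to [u = N], because [N x_i^(N-1) D_N] is still seen by [F N.-1]; the
   remainder, a multiple of [x_i^(N+1)], is invisible on both sides. *)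
rewrite {1}(slice_mx_sum N.+1 D) [in RHS](slice_mx_sum N.+1 D).
under eq_bigr => c _.
  rewrite commD comm_sum raddfD /= comm0 -!scalemxAl !FX.
  have -> : (N.+1 <= c)%N = false by have:= ltn_ord c; lia.
  rewrite ltnn subrr addr0 raddf_sum /=.
  under eq_bigr => u _ do rewrite commE.
  over.
rewrite exchange_big /=.
rewrite (eq_bigr (fun u : 'I_N.+1 => - (F (N - u)%N (v *m map_mx (slice i u) D) *+ u)));
  last by move=> u _; apply: trace_comm_psX; rewrite -ltnS.
rewrite sumrN; congr (- _).
rewrite map_mxD raddf_sum /= mulmxDr mulmx_sumr raddfD /= raddf_sum /=.
rewrite [X in _ + X](_ : _ = 0) ?addr0; last first.
  have -> : map_mx (psdiff i) (X N.+1 *: map_mx (shift i N.+1) D) =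
     X N *: (map_mx (shift i N.+1) D *+ N.+1) + X N.+1 *: map_mx (psdiff i) (map_mx (shift i N.+1) D).
    apply/matrixP => p q; rewrite !mxE mulmxnE !mxE psdiffM psdiff_psX /=.
    by rewrite mulrnAl mulrnAr.
  rewrite mulmxDr -!scalemxAr raddfD /= !FX.
  by have -> : (N <= N.-1)%N = false; [lia|]; have -> : (N < N.-1)%N = false; [lia|rewrite addr0].
apply: eq_bigr => u _.
have -> : map_mx (psdiff i) (X u *: map_mx (slice i u) D) =
     X u.-1 *: (map_mx (slice i u) D *+ u).
  apply/matrixP => p q; rewrite !mxE mulmxnE !mxE psdiffM psdiff_psX psdiff_slice mulr0 addr0.
  by rewrite mulrnAl mulrnAr.
case: u => [[|u] uN] /=; first by rewrite !mulr0n scaler0 mulmx0 raddf0.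
rewrite -scalemxAr (raddfMn (mulmx v)) /= FX raddfMn /=.
have -> : (u <= N.-1)%N by lia.
by congr (F _ _ *+ _); lia.
Qed.

End OneVariable.

(** * Homotopies and the Koszul complex on words *)

Section Homotopy.
Variables (R : pzRingType) (V : lmodType R) (I : eqType).
Variables (D : {additive V -> V}) (s S io : I -> {additive V -> V}).
Hypothesis DD : forall v, D (D v) = 0.
Hypothesis Ds : forall i v, D (s i v) = s i (D v).
Hypothesis sS : forall i j v, i != j -> s i (S j v) = S j (s i v).
Hypothesis s_io : forall i j v, s i (io j v) = io j (s i v).
Hypothesis SsK : forall i v, S i (s i v) = v.
Hypothesis Dio : forall i v, D (io i v) + io i (D v) = s i v.

Definition comm_op i v := D (S i v) - S i (D v).

Lemma comm_op_is_zmod i : zmod_morphism (comm_op i).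
Proof. by move=> u v; rewrite /comm_op (raddfB (S i)) !(raddfB D) (raddfB (S i)) !opprD !opprK addrACA. Qed.
HB.instance Definition _ i := GRing.isZmodMorphism.Build V V (comm_op i) (comm_op_is_zmod i).

Fixpoint comm_ops (l : seq I) (v : V) : V := if l is i :: l' then comm_ops l' (comm_op i v) else v.
Definition contractions (l : seq I) (v : V) : V := foldr (fun i => io i) v l.

Lemma comm_ops_is_zmod l : zmod_morphism (comm_ops l).
Proof. by elim: l => //= i l IH u v; rewrite raddfB IH. Qed.
HB.instance Definition _ l := GRing.isZmodMorphism.Build V V (comm_ops l) (comm_ops_is_zmod l).

Lemma comm_op_s i v : comm_op i (s i v) = 0.
Proof. by rewrite /comm_op SsK Ds SsK subrr. Qed.

Lemma comm_op_s_ne i j v : i != j -> comm_op j (s i v) = s i (comm_op j v).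
Proof. by move=> ij; rewrite /comm_op raddfB -Ds !sS // Ds. Qed.

Lemma comm_ops_s l j v : j \in l -> comm_ops l (s j v) = 0.
Proof.
elim: l v => //= i l IH v; rewrite inE.
have [-> _|ji /= jl] := eqVneq j i; first by rewrite comm_op_s raddf0.
by rewrite comm_op_s_ne // IH.
Qed.

Lemma D_comm_ops l v : D (comm_ops l v) = (-1) ^+ size l *: comm_ops l (D v).
Proof.
elim: l v => [|i l IH] v /=; first by rewrite scale1r.
rewrite IH exprS mulN1r scaleNr -scalerN -raddfN; congr (_ *: comm_ops l _).
by rewrite /comm_op DD (raddf0 (S i)) subr0 (raddfB D) DD sub0r.
Qed.

(** Each exchange of [D] with a contraction leaves a term in some [s_j], which [kap] kills, until
    [D v = 0] is reached. The map [kap] is arbitrary because the induction replaces it by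
    [kap \o io i]. *)
Lemma contractions_closed l v (kap : {additive V -> V}) : D v = 0 ->
  (forall j w, j \in l -> kap (s j w) = 0) -> kap (D (contractions l v)) = 0.
Proof.
move=> Dv; elim: l kap => [|i l IH] kap kaps /=; first by rewrite Dv raddf0.
have -> : D (io i (contractions l v)) =
    s i (contractions l v) - io i (D (contractions l v)) by rewrite -(Dio i) addrK.
rewrite raddfB /= kaps ?mem_head // sub0r; apply/eqP; rewrite oppr_eq0; apply/eqP.
apply: (IH (kap \o io i)) => j w jl /=.
by rewrite -s_io kaps // inE jl orbT.
Qed.

(* The homotopy [S_i io_i] turns [1] into [- [D, S_i] io_i]; the commutators can
   be moved in front of the contractions because they annihilate [s_j]. *)
Lemma homotopy_to_commutators l v : uniq l -> D v = 0 ->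
  exists h, v = (-1) ^+ size l *: comm_ops l (contractions l v) + D h.
Proof.
move=> ul Dv; elim: l ul => [_|i l IH] /=; first by exists 0; rewrite scale1r raddf0 addr0.
move=> /andP[il ul]; have [h vE] := IH ul.
set w := contractions l v in vE *.
have wE : w = D (S i (io i w)) + S i (io i (D w)) - comm_op i (io i w).
  rewrite /comm_op; have -> : D (io i w) = s i w - io i (D w).
    by rewrite -(Dio i w) addrK.
  by rewrite (raddfB (S i)) SsK opprB addrA addrACA subrr addr0 addrC addKr.
(* [D w] is made of terms in [s_j] with [j] in [l]; as [j] differs from [i], these [s_j] move out
   past [S_i io_i] and are killed by [comm_ops l]. *)
have k0 : comm_ops l (S i (io i (D w))) = 0.
  apply: (@contractions_closed l v (comm_ops l \o S i \o io i) Dv) => j u jl /=.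
  have ji : j != i by apply: contraNneq il => <-.
  by rewrite -s_io -sS // comm_ops_s.
exists (h + comm_ops l (S i (io i w))); rewrite raddfD /= D_comm_ops [LHS]vE {1}wE.
rewrite (raddfB (comm_ops l)) (raddfD (comm_ops l)) /= k0 addr0 scalerBr exprS mulN1r scaleNr.
by rewrite [X in X + _ = _]addrC -addrA [X in _ + X = _]addrC.
Qed.

End Homotopy.

Section Ideal.
Variables (k : fieldType) (n : nat) (f : 'I_n -> ps k n).
Local Notation ps := (ps k n).
Implicit Types x y : ps.

Definition ideal x := exists c : 'I_n -> ps, x = \sum_i c i * f i.

Lemma ideal0 : ideal 0.
Proof. by exists (fun=> 0); rewrite big1 // => i _; rewrite mul0r. Qed.

Lemma idealD x y : ideal x -> ideal y -> ideal (x + y).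
Proof.
move=> [c ->] [d ->]; exists (fun i => c i + d i); rewrite -big_split /=.
by apply: eq_bigr => i _; rewrite mulrDl.
Qed.

Lemma idealM x y : ideal y -> ideal (x * y).
Proof.
move=> [c ->]; exists (fun i => x * c i); rewrite mulr_sumr.
by apply: eq_bigr => i _; rewrite mulrA.
Qed.

Lemma idealN x : ideal x -> ideal (- x).
Proof. by rewrite -mulN1r; apply: idealM. Qed.

Lemma idealB x y : ideal x -> ideal y -> ideal (x - y).
Proof. by move=> ix iy; apply: idealD => //; apply: idealN. Qed.

Lemma ideal_sum I (r : seq I) (P : pred I) (F : I -> ps) :
  (forall i, P i -> ideal (F i)) -> ideal (\sum_(i <- r | P i) F i).
Proof. by move=> iF; elim/big_ind: _ => //; [exact: ideal0 | exact: idealD]. Qed.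

Lemma ideal_gen i : ideal (f i).
Proof.
exists (fun j => (i == j)%:R); rewrite (bigD1 i) //= eqxx mul1r big1 ?addr0 // => j.
by rewrite eq_sym => /negPf ->; rewrite mul0r.
Qed.

End Ideal.

(** Cochains live on all words rather than on increasing ones, because the traces to be studied
    alternate only modulo an ideal. *)
Definition cochain (k : fieldType) (n : nat) := seq 'I_n -> ps k n.

Section CochainModule.
Variables (k : fieldType) (n : nat).
Local Notation ps := (ps k n).
Local Notation cochain := (cochain k n).
Implicit Types g h : cochain.

Definition coadd g h : cochain := fun J => g J + h J.
Definition coopp g : cochain := fun J => - g J.
Definition coscale (x : ps) g : cochain := fun J => x * g J.
Lemma coaddA : associative coadd.
Proof. by move=> ? ? ?; apply/funext => J; rewrite /coadd addrA. Qed.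
Lemma coaddC : commutative coadd.
Proof. by move=> ? ?; apply/funext => J; rewrite /coadd addrC. Qed.
Lemma coadd0 : left_id (fun=> 0) coadd.
Proof. by move=> ?; apply/funext => J; rewrite /coadd add0r. Qed.
Lemma coaddN : left_inverse (fun=> 0) coopp coadd.
Proof. by move=> ?; apply/funext => J; rewrite /coadd addNr. Qed.
HB.instance Definition _ := gen_eqMixin cochain.
HB.instance Definition _ := gen_choiceMixin cochain.
HB.instance Definition _ := GRing.isZmodule.Build cochain coaddA coaddC coadd0 coaddN.
Lemma coscaleA x y g : coscale x (coscale y g) = coscale (x * y) g.
Proof. by apply/funext => J; rewrite /coscale mulrA. Qed.
Lemma coscale1 : left_id 1 coscale.
Proof. by move=> ?; apply/funext => J; rewrite /coscale mul1r. Qed.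
Lemma coscaleDr : right_distributive coscale +%R.
Proof. by move=> ? ? ?; apply/funext => J; rewrite /coscale [LHS]mulrDr. Qed.
Lemma coscaleDl g : {morph coscale^~ g : x y / x + y}.
Proof. by move=> ? ?; apply/funext => J; rewrite /coscale [LHS]mulrDl. Qed.
HB.instance Definition _ := GRing.Zmodule_isLmodule.Build ps cochain
  coscaleA coscale1 coscaleDr coscaleDl.

Lemma cochainD g h J : (g + h) J = g J + h J. Proof. by []. Qed.
Lemma cochainB g h J : (g - h) J = g J - h J. Proof. by []. Qed.
Lemma cochainN g J : (- g) J = - g J. Proof. by []. Qed.
Lemma cochainZ (x : ps) g J : (x *: g) J = x * g J. Proof. by []. Qed.
Definition cochainE := (cochainD, cochainB, cochainN, cochainZ).

End CochainModule.

Section Words.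
Variables (k : fieldType) (n : nat).
Local Notation ps := (ps k n).
Local Notation cochain := (cochain k n).
Implicit Types (g h : cochain) (J : seq 'I_n).

(** The signed sum over the letters [j] of [J] of [F j] applied to [g] on [J] without that letter.
    Multiplication by [f j] gives the Koszul differential; a general [F] also covers its commutator
    with [S_i], as in [comm_op_delta]. *)
Fixpoint delta (F : 'I_n -> ps -> ps) g J : ps :=
  if J is j :: J' then F j (g J') - delta F (fun L => g (j :: L)) J' else 0.

Lemma eq_delta F g h J : (forall L, (size L).+1 = size J -> g L = h L) -> delta F g J = delta F h J.
Proof.
elim: J g h => //= j J IH g h e; rewrite e //; congr (_ - _); apply: IH => L sL.
by apply: e => /=; rewrite sL.
Qed.

Lemma deltaB (F : 'I_n -> ps -> ps) g h J : (forall j, zmod_morphism (F j)) ->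
  delta F (g - h) J = delta F g J - delta F h J.
Proof.
move=> FB; elim: J g h => [|j J IH] g h /=; first by rewrite subr0.
rewrite cochainE FB [X in _ - X](IH (fun L => g (j :: L)) (fun L => h (j :: L))).
by rewrite !opprD !opprK addrACA.
Qed.

Definition alternating g := forall w1 i j w2,
  g (w1 ++ i :: j :: w2) = - g (w1 ++ j :: i :: w2).

Lemma alternating_delta F g : (forall j, zmod_morphism (F j)) ->
  alternating g -> alternating (delta F g).
Proof.
move=> FB galt w1 i j w2.
have FN a x : F a (- x) = - F a x.
  have F0 : F a 0 = 0 by have := FB a 0 0; rewrite !subrr.
  by rewrite -[- x]sub0r FB F0 sub0r.
elim: w1 g galt => [|a w1 IH] g galt /=; last first.
  rewrite galt FN (IH (fun L => g (a :: L))); first by rewrite opprK opprB addrC.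
  by move=> u1 b c u2; apply: (galt (a :: u1)).
rewrite !opprB; have -> : delta F (fun L => g [:: i, j & L]) w2
    = - delta F (fun L => g [:: j, i & L]) w2.
  have d0 : delta F 0 w2 = 0 by have := deltaB 0 0 w2 FB; rewrite !subrr.
  rewrite -[RHS]sub0r -[0 in RHS]d0 -deltaB //; apply: eq_delta => L _.
  by rewrite cochainE (galt [::]) sub0r.
by rewrite addrA.
Qed.

Definition supported (p : nat) g := forall J, size J != p -> g J = 0.

Variables (f : 'I_n -> ps) (A : 'M[ps]_n) (N : nat).
Hypothesis hA : forall i, psX k i N = \sum_j A i j * f j.

Definition kdiff g : cochain := delta (fun j x => f j * x) g.
Definition kmul (i : 'I_n) g : cochain := fun J => psX k i N * g J.
Definition kshift (i : 'I_n) g : cochain := fun J => shift i N (g J).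
(** Contraction against row [i] of [A], the null-homotopy of [x_i^N] on cochains. *)
Definition kiota (i : 'I_n) g : cochain := fun J => \sum_l A i l * g (l :: J).

Lemma kdiff_is_zmod : zmod_morphism kdiff.
Proof.
move=> g h; apply/funext => J; rewrite cochainE; apply: deltaB => j x y.
exact: mulrBr.
Qed.
HB.instance Definition _ := GRing.isZmodMorphism.Build cochain cochain kdiff kdiff_is_zmod.

Lemma kmul_is_zmod i : zmod_morphism (kmul i).
Proof. by move=> g h; apply/funext => J; rewrite /kmul !cochainE mulrBr. Qed.
HB.instance Definition _ i := GRing.isZmodMorphism.Build cochain cochain (kmul i) (kmul_is_zmod i).

Lemma kshift_is_zmod i : zmod_morphism (kshift i).
Proof. by move=> g h; apply/funext => J; rewrite /kshift !cochainE raddfB. Qed.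
HB.instance Definition _ i := GRing.isZmodMorphism.Build cochain cochain (kshift i) (kshift_is_zmod i).

Lemma kiota_is_zmod i : zmod_morphism (kiota i).
Proof.
move=> g h; apply/funext => J; rewrite /kiota !cochainE -sumrB.
by apply: eq_bigr => l _; rewrite cochainE mulrBr.
Qed.
HB.instance Definition _ i := GRing.isZmodMorphism.Build cochain cochain (kiota i) (kiota_is_zmod i).

Lemma kdiffZ (x : ps) g : kdiff (x *: g) = x *: kdiff g.
Proof.
apply/funext => J; rewrite cochainZ /kdiff; elim: J g => [|j J IH] g /=; first by rewrite mulr0.
rewrite cochainZ mulrCA mulrBr; congr (_ - _).
exact: (IH (fun L => g (j :: L))).
Qed.

Lemma kdiffK g : kdiff (kdiff g) = 0.
Proof.
apply/funext => J; elim: J g => [|j J IH] g //=.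
transitivity (f j * kdiff g J - kdiff (f j *: (g : cochain) - kdiff (fun L => g (j :: L))) J) => //.
by rewrite raddfB /= cochainB kdiffZ cochainZ IH subr0 subrr.
Qed.

(** Deleting the first letter in [kdiff g (l :: J)] gives [f l * g J]; the other deletions cancel
    against [kdiff (kiota i g)]. Row [i] of [A] then combines the [f l] into [x_i^N]. *)
Lemma kdiff_iota i g : kdiff (kiota i g) + kiota i (kdiff g) = kmul i g.
Proof.
apply/funext => J; rewrite cochainE.
have -> : kdiff (kiota i g) J = \sum_l A i l * kdiff (fun L => g (l :: L)) J.
  have -> : kiota i g = \sum_l A i l *: ((fun L => g (l :: L)) : cochain).
    apply/funext => L; rewrite /kiota.
    elim/big_ind2: _ => // x x' y y' ex ey; first by rewrite cochainE ex ey.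
  rewrite raddf_sum /=.
  elim/big_ind2: _ => // [x x' y y' ex ey|l _]; first by rewrite cochainE ex ey.
  by rewrite kdiffZ cochainZ.
rewrite /kiota -big_split /= /kmul hA mulr_suml; apply: eq_bigr => l _.
by rewrite -mulrDr /= addrC subrK mulrA.
Qed.

Lemma kdiff_ideal g J : ideal f (kdiff g J).
Proof.
rewrite /kdiff; elim: J g => [|j J IH] g /=; first exact: ideal0.
by apply: idealB => //; rewrite mulrC; apply: idealM; apply: ideal_gen.
Qed.

Lemma koszul_homotopy g : kdiff g = 0 ->
  exists h, g = (-1) ^+ size (enum 'I_n) *:
    comm_ops kdiff kshift (enum 'I_n) (contractions kiota (enum 'I_n) g) + kdiff h.
Proof.
apply: (homotopy_to_commutators (s := kmul)) => //; last exact: enum_uniq.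
- exact: kdiffK.
- by move=> i v; apply: (kdiffZ (psX k i N) v).
- by move=> i j v ij; apply/funext => J; rewrite /= /kmul /kshift shift_psX_ne // eq_sym.
- move=> i j v; apply/funext => J; rewrite /= /kmul /kiota mulr_sumr.
  by apply: eq_bigr => l _; rewrite mulrCA.
- by move=> i v; apply/funext => J; rewrite /= /kmul /kshift shift_psX.
- exact: kdiff_iota.
Qed.

Lemma supported_contractions (p : nat) l g : supported p g ->
  supported (p - size l)%N (contractions kiota l g) /\ ((p < size l)%N -> contractions kiota l g = 0).
Proof.
move=> gp; elim: l => [|i l [IH IH0]] /=; first by rewrite subn0.
have iota0 : kiota i 0 = 0 by rewrite raddf0.
have [lp|pl] := ltnP p (size l); first by rewrite IH0 // iota0.
split=> [J sJ|pl']; last first.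
  have ep : p = size l by apply/eqP; rewrite eqn_leq pl andbT -ltnS.
  apply/funext => J; rewrite /kiota big1 // => j _; rewrite (IH (j :: J)) ?mulr0 //=.
  by rewrite ep subnn.
rewrite /kiota big1 // => j _; rewrite (IH (j :: J)) ?mulr0 //=.
by apply: contraNneq sJ => e; rewrite subnS -e.
Qed.

(** Each contraction lowers the supporting length by one, so [n] of them kill [g]. Hence [g] is a
    coboundary, and values of coboundaries lie in the ideal. *)
Theorem koszul_low p g J : (p < n)%N -> supported p g -> kdiff g = 0 -> ideal f (g J).
Proof.
move=> pn gp /koszul_homotopy[h gE].
have [_ c0] := supported_contractions (enum 'I_n) gp.
rewrite gE c0 ?size_enum_ord // (raddf0 (comm_ops kdiff kshift (enum 'I_n))).
by rewrite scaler0 add0r; apply: kdiff_ideal.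
Qed.

Lemma comm_op_delta i g : comm_op kdiff kshift i g =
  delta (fun j x => f j * shift i N x - shift i N (f j * x)) g.
Proof.
apply/funext => J; rewrite /comm_op /= cochainB /kshift /kdiff.
elim: J g => [|j J IH] g /=; first by rewrite subrr.
by rewrite -(IH (fun L => g (j :: L))) raddfB /= !opprD !opprK addrACA.
Qed.

Lemma alternating_comm_ops l g : alternating g -> alternating (comm_ops kdiff kshift l g).
Proof.
elim: l g => //= i l IH g galt; apply: IH; rewrite comm_op_delta.
apply: alternating_delta => // j x y; rewrite raddfB !mulrBr raddfB /=.
by rewrite !opprD !opprK addrACA.
Qed.

(** Here [n] contractions leave a cochain supported on the empty word, which alternates trivially,
    and the commutators preserve alternation. So [g] alternates up to a coboundary. *)
Theorem koszul_top g : supported n g -> kdiff g = 0 ->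
  forall w1 i j w2, ideal f (g (w1 ++ i :: j :: w2) + g (w1 ++ j :: i :: w2)).
Proof.
move=> gn /koszul_homotopy[h gE] w1 i j w2.
have [c0 _] := supported_contractions (enum 'I_n) gn.
rewrite size_enum_ord subnn in c0.
rewrite gE !cochainE alternating_comm_ops.
  by rewrite mulrN addrACA addNr add0r; apply: idealD; apply: kdiff_ideal.
by move=> u1 a b u2; rewrite !c0 ?oppr0 // size_cat /= addnS.
Qed.

End Words.

(** * Supertraces on cohomology *)

Section FiniteModel.
Variables (k : fieldType) (R : comNzRingType) (iota : {rmorphism k -> R}) (Z : lmodType R).
Variable m : nat.
Local Notation C := 'rV[k]_m.

Definition comb N (c : 'I_N -> k) (z : 'I_N -> Z) : Z := \sum_l iota (c l) *: z l.

Lemma combB N (c c' : 'I_N -> k) z : comb (fun l => c l - c' l) z = comb c z - comb c' z.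
Proof. by rewrite /comb -sumrB; apply: eq_bigr => l _; rewrite rmorphB scalerBl. Qed.

Variables (p : {additive Z -> C}) (j : {additive C -> Z}).
Hypothesis pZ : forall c v, p (iota c *: v) = c *: p v.
Hypothesis jZ : forall c u, j (c *: u) = iota c *: j u.

Lemma p_comb N (c : 'I_N -> k) z : p (comb c z) = \sum_l c l *: p (z l).
Proof. by rewrite raddf_sum; apply: eq_bigr => l _; rewrite /= pZ. Qed.

Section Trace.
Variables (D : {additive Z -> Z}) (d T G : 'M[k]_m).
Hypothesis DZ : forall c v, D (iota c *: v) = iota c *: D v.
Hypothesis Dj : forall c, D (j c) = j (c *m d).
Hypothesis pD : forall v, p (D v) = p v *m d.
Hypothesis pj : forall c, p (j c) = c *m T.
Hypothesis dd : d *m d = 0.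
Hypothesis Gd : G *m d = - (d *m G).

Variables (N : nat) (z : 'I_N -> Z) (eps : 'I_N -> k) (Mx : 'M[k]_N).
Hypothesis Dz : forall l, D (z l) = 0.
Hypothesis zG : forall l, p (z l) *m G = eps l *: p (z l).
Hypothesis span : forall v, D v = 0 -> exists c u, v = comb c z + D u.
Hypothesis indep : forall c u, comb c z = D u -> forall l, c l = 0.
Hypothesis act : forall l, exists u, j (p (z l)) = comb (Mx l) z + D u.

(** With a generalised inverse [e] of [d], [P] projects onto cycles and [Q] onto boundaries, and the
    supertrace on [C] is that on cycles minus that on boundaries. On cycles [T] is [q zeta] plus a
    term ending in [d], where [q] reads off coordinates in the basis [z] and [zeta] lists the images
    of the basis in [C]. The terms in [d] cancel, [q] vanishes on boundaries, and the trace of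
    [zeta G q] is left. *)
Lemma supertrace_homology : \tr (T *m G) = \sum_l eps l * Mx l l.
Proof.
have dT : d *m T = T *m d.
  apply/row_matrixP => i; rewrite !row_mul -pj [row i T]rowE -pj -pD.
  by rewrite Dj -rowE.
have [e ded] : exists e, d *m e *m d = d by exists (pinvmx d); rewrite mulmxKpV.
pose P := 1%:M - d *m e; pose Q := e *m d.
have dQ : d *m Q = d by rewrite /Q mulmxA.
have Pd : P *m d = 0 by rewrite /P mulmxBl mul1mx -mulmxA dQ subrr.
have dP : d *m P = d by rewrite /P mulmxBr mulmx1 mulmxA dd mul0mx subr0.
have QP : Q *m P = Q by rewrite /Q -mulmxA dP.
have /choice[qu quE] : forall i, exists qu : ('I_N -> k) * Z, j (row i P) = comb qu.1 z + D qu.2.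
  move=> i; have /span[c [u ue]] : D (j (row i P)) = 0 by rewrite Dj -row_mul Pd row0 raddf0.
  by exists (c, u).
pose q : 'M[k]_(m, N) := \matrix_(i, l) (qu i).1 l.
pose zeta : 'M[k]_(N, m) := \matrix_l p (z l).
have jP (c : C) : exists u, j (c *m P) = comb (fun l => (c *m q) 0 l) z + D u.
  exists (\sum_i iota (c 0 i) *: (qu i).2).
  rewrite mulmx_sum_row raddf_sum /= raddf_sum /= /comb.
  under [X in X + _]eq_bigr => l _ do rewrite mxE rmorph_sum /= scaler_suml.
  rewrite exchange_big -big_split /=; apply: eq_bigr => i _.
  rewrite jZ quE DZ scalerDr /comb scaler_sumr; congr (_ + _).
  by apply: eq_bigr => l _; rewrite !mxE rmorphM scalerA.
(* [j] sends boundaries of [C] to boundaries of [Z], and independence makes their coordinates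
   zero. *)
have dq : d *m q = 0.
  apply/matrixP => i l; rewrite mxE.
  have [u ue] := jP (row i d).
  have /indep/(_ l) : comb (fun l => (row i d *m q) 0 l) z = D (j (delta_mx 0 i) - u).
    rewrite raddfB /= Dj -rowE.
    have -> : j (row i d) = j (row i d *m P) by rewrite -row_mul dP.
    by rewrite ue addrK.
  move=> e0; rewrite [RHS]mxE; apply: etrans e0; rewrite [RHS]mxE.
  by apply: eq_bigr => x _; rewrite [row _ _ _ _]mxE.
(* [act] and [jP] expand the same vector [j (p (z l))], so the coordinates agree. *)
have zq : zeta *m q = Mx.
  apply/matrixP => l l'; have [u] := jP (row l zeta); have [u' u'E] := act l.
  have -> : row l zeta *m P = p (z l).
    by rewrite rowK /P mulmxBr mulmx1 mulmxA -pD Dz raddf0 mul0mx subr0.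
  rewrite u'E => ue; have : comb (fun l1 => Mx l l1 - (row l zeta *m q) 0 l1) z = D (u - u').
    by rewrite combB raddfB /=; apply/eqP; rewrite subr_eq addrAC eq_sym subr_eq addrC -ue.
  move=> /indep/(_ l')/eqP; rewrite subr_eq0 => /eqP ->.
  by rewrite -row_mul [RHS]mxE.
pose r : 'M[k]_m := \matrix_i p (qu i).2.
have rK i : row i r = p (qu i).2 by rewrite /r rowK.
have zK l : row l zeta = p (z l) by rewrite /zeta rowK.
have PT : P *m T = q *m zeta + r *m d.
  apply/row_matrixP => i; rewrite row_mul -pj quE raddfD /= pD raddfD /= !row_mul rK.
  congr (_ + _); rewrite p_comb mulmx_sum_row; apply: eq_bigr => l _.
  by rewrite zK !mxE.
have zetaG : zeta *m G = diag_mx (\row_l eps l) *m zeta.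
  by apply/row_matrixP => l; rewrite row_mul zK zG mul_diag_mx; apply/rowP => x; rewrite !mxE.
(* [d] commutes with [T] and anticommutes with [G], so cycling it round the trace turns
   [1 - P = d e] into [- Q]. *)
have -> : \tr (T *m G) = \tr (P *m T *m G) - \tr (Q *m T *m G).
  have tP : \tr (P *m T *m G) = \tr (T *m G) - \tr (T *m G *m d *m e).
    by rewrite -mulmxA mxtrace_mulC /P mulmxBr mulmx1 raddfB /= mulmxA.
  have tQ : \tr (Q *m T *m G) = - \tr (T *m G *m d *m e).
    rewrite /Q -!mulmxA mxtrace_mulC !mulmxA dT -(mulmxA T G d) Gd mulmxN mulNmx raddfN /=.
    by rewrite opprK !mulmxA.
  by rewrite tP tQ opprK subrK.
rewrite -QP -(mulmxA Q) PT mulmxDr !mulmxDl !mxtraceD.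
have -> : Q *m (q *m zeta) = 0 by rewrite /Q -!mulmxA (mulmxA d) dq mul0mx mulmx0.
rewrite mul0mx mxtrace0 add0r.
have -> : \tr (Q *m (r *m d) *m G) = \tr (r *m d *m G).
  rewrite -mulmxA mxtrace_mulC -!mulmxA (mulmxA d G Q).
  have -> : d *m G = - (G *m d) by rewrite Gd opprK.
  by rewrite mulNmx -mulmxA dQ.
rewrite addrK -mulmxA zetaG mxtrace_mulC -mulmxA zq.
by apply: eq_bigr => l _; rewrite mul_diag_mx !mxE.
Qed.

End Trace.

Section Basis.
Variables (Zc Bd : Z -> Prop).
Hypothesis ZcD : forall u v, Zc u -> Zc v -> Zc (u + v).
Hypothesis ZcZ : forall c u, Zc u -> Zc (iota c *: u).
Hypothesis BdZ : forall c u, Bd u -> Bd (iota c *: u).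
Hypothesis Zc0 : Zc 0.
Hypothesis pBd : forall u, Zc u -> p u = 0 -> Bd u.

Let family N z := (forall l : 'I_N, Zc (z l)) /\
  (forall c, Bd (comb c z) -> forall l, c l = 0).

(** [pBd] makes [p] injective on cohomology, so independent families have at most [m] members. One
    of maximal size spans: a dependence that appears on adding [v] must involve [v]. *)
Lemma basis_exists : exists N (z : 'I_N -> Z),
  [/\ forall l, Zc (z l),
      forall v, Zc v -> exists c, Bd (v - comb c z)
    & forall c, Bd (comb c z) -> forall l, c l = 0].
Proof.
have bound N : (exists z : 'I_N -> Z, family z) -> (N <= m)%N.
  move=> [z [zZ zind]]; suff /eqP <- : row_free (\matrix_l p (z l)) by apply: rank_leq_col.
  rewrite -kermx_eq0; apply/rowV0P => c /sub_kermxP c0.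
  have /zind cl : Bd (comb (c 0) z).
    apply: pBd; first by rewrite /comb; elim/big_ind: _ => // l _; apply: ZcZ.
    rewrite p_comb -[RHS]c0 mulmx_sum_row.
    by apply: eq_bigr => l _; rewrite rowK.
  by apply/rowP => l; rewrite cl mxE.
pose P N := `[< exists z : 'I_N -> Z, family z >].
have P0 : exists N, P N.
  exists 0%N; apply/asboolP; exists (fun=> 0); split=> [[]|c _ []] //.
have Pb N : P N -> (N <= m)%N by move/asboolP/bound.
have [N /asboolP[z [zZ zind]] Nmax] := ex_maxnP P0 Pb.
exists N, z; split=> // v Zv.
have /asboolPn/forallNP/(_ (fun l : 'I_N.+1 => oapp z v (unlift ord_max l))) : ~~ P N.+1.
  by apply/negP => /Nmax; rewrite ltnn.
move/not_andP => [[]l|].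
  by case: unliftP => [x|] _ /=; [apply: zZ | apply: Zv].
move/existsNP => [c /not_implyP[Bc /existsNP[l0 cl0]]].
have combE : comb c (fun l : 'I_N.+1 => oapp z v (unlift ord_max l)) =
    comb (fun l => c (lift ord_max l)) z + iota (c ord_max) *: v.
  rewrite /comb big_ord_recr /= unlift_none /=; congr (_ + _).
  apply: eq_bigr => l _; have -> : widen_ord (leqnSn N) l = lift ord_max l.
    by apply/val_inj; rewrite /= /bump leqNgt ltn_ord.
  by rewrite liftK.
rewrite combE in Bc.
have cn0 : c ord_max != 0.
  apply/eqP => c0; rewrite c0 rmorph0 scale0r addr0 in Bc; apply: cl0.
  by case: (unliftP ord_max l0) => [l|] -> //; apply: (zind _ Bc).
exists (fun l => - c (lift ord_max l) / c ord_max).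
move: Bc => /(BdZ (c ord_max)^-1); rewrite scalerDr scalerA -rmorphM mulVf // rmorph1 scale1r.
rewrite addrC; congr (Bd (v + _)); rewrite /comb scaler_sumr -sumrN.
by apply: eq_bigr => l _; rewrite scalerA -rmorphM -scaleNr -rmorphN mulrC mulNr opprK.
Qed.

End Basis.
End FiniteModel.

(** * The residue symbol *)

Section Residue.
Variables (k : fieldType) (n : nat).
Local Notation ps := (ps k n).
Implicit Types (f : 'I_n -> ps) (A B : 'M[ps]_n) (h x y : ps).

(** The value that the transformation law prescribes for one choice of [x_i^N = sum_j A_ij f_j];
    [residue_unique] shows that the choice does not matter. *)
Definition residue h N A := cf (monoc n N.-1) (h * \det A).
Definition power_relation f N A := (0 < N)%N /\ forall i, psX k i N = \sum_j A i j * f j.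

Lemma cf_top_ideal N y : (0 < N)%N -> ideal (fun i => psX k i N) y -> cf (monoc n N.-1) y = 0.
Proof.
move=> N0 [c ->]; rewrite raddf_sum big1 // => i _ /=; rewrite mulrC cf_psX_mul ffunE.
by have -> : (N <= N.-1)%N = false by lia.
Qed.

Lemma cramer_ideal f b A x : (forall i, b i = \sum_j A i j * f j) -> ideal f x ->
  ideal b (\det A * x).
Proof.
move=> bE [c ->]; rewrite mulr_sumr; apply: ideal_sum => j _.
rewrite mulrCA; apply: idealM.
have -> : \det A * f j = \sum_i \adj A j i * b i.
  transitivity (\sum_l (\adj A *m A) j l * f l).
    rewrite mul_adj_mx (bigD1 j) //= big1 ?addr0 => [|l /negPf jl]; rewrite !mxE ?eqxx //.
    by rewrite eq_sym jl mul0r.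
  under eq_bigr => l _ do rewrite mxE mulr_suml.
  rewrite exchange_big; apply: eq_bigr => i _ /=; rewrite bE mulr_sumr.
  by apply: eq_bigr => l _; rewrite mulrA.
by apply: ideal_sum => i _; apply: idealM; apply: ideal_gen.
Qed.

Lemma residue_kills_ideal f N A x : power_relation f N A -> ideal f x -> residue x N A = 0.
Proof.
move=> [N0 hA] fx; apply: cf_top_ideal => //; rewrite mulrC.
by apply: cramer_ideal fx => i; apply: hA.
Qed.

Lemma residueB h h' N A : residue (h - h') N A = residue h N A - residue h' N A.
Proof. by rewrite /residue mulrBl raddfB. Qed.

Lemma residue_congr f N A h h' : power_relation f N A -> ideal f (h - h') ->
  residue h N A = residue h' N A.
Proof.
by move=> vA /(residue_kills_ideal vA)/eqP; rewrite residueB subr_eq0 => /eqP.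
Qed.

(** The determinants differ by [det C], where row [i0] of [C] is a relation among the [f_j] with
    value zero. Cramer's rule puts [x_(i0)^N det C] in the ideal of the other [x_i^N]. These do not
    involve [x_(i0)], so [det C] lies in that ideal too, and the coefficient at [(N-1, ..., N-1)]
    vanishes on it. *)
Lemma residue_change_row f N A B i0 h : power_relation f N A -> power_relation f N B ->
  row' i0 A = row' i0 B -> residue h N A = residue h N B.
Proof.
move=> [N0 hA] [_ hB] eAB.
pose C := \matrix_(i, j) (if i == i0 then A i0 j - B i0 j else A i j).
have detC : \det C = \det A - \det B.
  have -> : \det A - \det B = 1 * \det A + (-1) * \det B by rewrite mul1r mulN1r.
  apply: (@determinant_multilinear _ _ _ _ _ i0).
  - by apply/rowP => j; rewrite !mxE eqxx mul1r mulN1r.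
  - by apply/matrixP => i j; rewrite !mxE eq_sym (negPf (neq_lift _ _)).
  - by rewrite -eAB; apply/matrixP => i j; rewrite !mxE eq_sym (negPf (neq_lift _ _)).
pose b i := if i == i0 then 0 else psX k i N.
have bE i : b i = \sum_j C i j * f j.
  rewrite /b; case: eqP => [->|/eqP/negPf ni].
    under eq_bigr => j _ do rewrite mxE eqxx mulrBl.
    by rewrite sumrB -hA -hB subrr.
  by rewrite hA; apply: eq_bigr => j _; rewrite mxE ni.
have [c cE] : ideal b (\det C * psX k i0 N).
  by apply: cramer_ideal bE _; rewrite hA; apply: ideal_sum => j _; apply: idealM; apply: ideal_gen.
suff iC : ideal (fun i => psX k i N) (\det C).
  apply/eqP; rewrite -subr_eq0 /residue -raddfB -mulrBr -detC; apply/eqP.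
  by apply: cf_top_ideal => //; apply: idealM.
(* Division by [x_(i0)^N] is linear over powers of the other variables, so it cancels the factor
   without leaving the ideal. *)
rewrite -(shift_psX i0 N (\det C)) mulrC cE raddf_sum /=; apply: ideal_sum => i _.
rewrite /b; case: eqP => [_|/eqP ni]; first by rewrite mulr0 raddf0; apply: ideal0.
rewrite mulrC shift_psX_ne 1?eq_sym // mulrC; apply: idealM.
exact: (ideal_gen (fun i => psX k i N)).
Qed.

(** The rows of [A] are replaced by those of [B] one at a time. *)
Lemma residue_same_power f N A B h : power_relation f N A -> power_relation f N B ->
  residue h N A = residue h N B.
Proof.
move=> vA vB.
pose C t := \matrix_(i, j) (if (i < t)%N then B i j else A i j) : 'M[ps]_n.
have vC t : power_relation f N (C t).
  split=> [|i]; first by case: vA.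
  case: (ltnP i t) => it; [case: vB => _ -> | case: vA => _ ->];
    by apply: eq_bigr => j _; rewrite mxE ?it // ltnNge it.
have C0 : C 0%N = A by apply/matrixP => i j; rewrite mxE.
have Cn : C n = B by apply/matrixP => i j; rewrite mxE ltn_ord.
rewrite -C0 -Cn; move: (leqnn n); elim: {-2}n => // t IH tn; rewrite IH ?(ltnW tn) //.
apply: (@residue_change_row f N _ _ (Ordinal tn)) => //.
apply/matrixP => i j; rewrite !mxE; congr (if _ then _ else _).
have : lift (Ordinal tn) i != t :> nat by have := neq_lift (Ordinal tn) i; rewrite eq_sym.
by rewrite -[RHS]/(_ <= _)%N => li; rewrite [RHS]leq_eqVlt eqSS (negPf li).
Qed.

Lemma power_relation_raise f N A e : power_relation f N A ->
  power_relation f (N + e) (\matrix_(i, j) (psX k i e * A i j)).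
Proof.
move=> [N0 hA]; split=> [|i]; first by rewrite addn_gt0 N0.
rewrite addnC psX_D hA mulr_sumr; apply: eq_bigr => j _; by rewrite mxE mulrA.
Qed.

Lemma prod_psX e : \prod_(i < n) psX k i e = mon k (monoc n e).
Proof.
have -> : monoc n e = \big[@madd n/mono0 n]_(i < n) monoX i e.
  apply: monoP => j; rewrite ffunE.
  transitivity (\sum_(i < n) monoX i e j)%N; last first.
    by elim/big_ind2: _ => [|x y x' y' -> ->|//]; rewrite ffunE.
  rewrite (bigD1 j) //= ffunE eqxx big1 ?addn0 // => i /negPf ij.
  by rewrite ffunE eq_sym ij.
by elim/big_ind2: _ => [|x y x' y' -> ->|//]; rewrite ?mon0 ?monD.
Qed.

(** The new determinant is [(x_1 ... x_n)^e] times the old one, and the coefficient is read [e]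
    places higher in every variable. *)
Lemma residue_raise N A e h : (0 < N)%N ->
  residue h (N + e) (\matrix_(i, j) (psX k i e * A i j)) = residue h N A.
Proof.
move=> N0; rewrite /residue.
have -> : \matrix_(i, j) (psX k i e * A i j) = diag_mx (\row_i psX k i e) *m A.
  by rewrite mul_diag_mx; apply/matrixP => i j; rewrite !mxE.
rewrite det_mulmx det_diag; under eq_bigr => i _ do rewrite mxE.
rewrite prod_psX mulrCA cf_mon_mul.
have -> : monoc n (N + e).-1 = madd (monoc n N.-1) (monoc n e).
  by apply: monoP => i; rewrite !ffunE; lia.
by rewrite maddC mle_addr maddC maddK.
Qed.

Lemma residue_unique f N A N' A' h : power_relation f N A -> power_relation f N' A' ->
  residue h N A = residue h N' A'.
Proof.
move=> vA vA'; have [N0 _] := vA; have [N0' _] := vA'.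
rewrite -(residue_raise A N' h N0) -(residue_raise A' N h N0').
rewrite [(N' + N)%N]addnC; apply: (@residue_same_power f).
  exact: (power_relation_raise N' vA).
by rewrite addnC; apply: (power_relation_raise N vA').
Qed.

Lemma cf_exp_high g j m : cf (mono0 n) g = 0 -> (mdeg m < j)%N -> cf m (g ^+ j) = 0 :> k.
Proof.
move=> g0; elim: j m => // j IH m mj; rewrite exprS cf_mul big1_seq // => a /andP[_].
rewrite mem_below => am; have [->|an0] := eqVneq a (mono0 n); first by rewrite g0 mul0r.
rewrite IH ?mulr0 //; apply: leq_trans (_ : mdeg m <= j)%N; last by rewrite -ltnS.
rewrite -{2}(msubK am) mdeg_add -[X in (X < _)%N]add0n ltn_add2r lt0n.
apply: contraNneq an0 => /eqP; rewrite sum_nat_eq0 => /forallP a0; apply/eqP.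
by apply: monoP => i; rewrite ffunE; apply/eqP; have := a0 i.
Qed.

(** After scaling, [y = 1 - g] with [g] of zero constant term. The geometric series in [g] is cut
    off at the degree of each monomial, which higher powers of [g] do not reach. *)
Lemma ps_invertible y : cf (mono0 n) y != 0 -> exists v, y * v = 1.
Proof.
set c := cf _ y => c0; pose g : ps := 1 - psC c^-1 * y.
have g0 : cf (mono0 n) g = 0.
  by rewrite /g raddfB /= cf_psC_mul mulVf // -[X in cf _ X]mon0 cf_mon eqxx subrr.
pose v : ps := fun m => cf m (\sum_(j < (mdeg m).+1) g ^+ j).
have vE (m : mono n) (B : nat) : (mdeg m < B)%N -> cf m v = cf m (\sum_(j < B) g ^+ j).
  move=> mB; rewrite [LHS]/cf /v -!(big_mkord xpredT (fun j => g ^+ j)).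
  rewrite [in RHS](@big_cat_nat _ _ _ (mdeg m).+1) //= raddfD /=.
  rewrite [X in _ + X]raddf_sum /= [X in _ + X]big_nat [X in _ + X]big1 ?addr0 // => j /andP[mj _].
  exact: cf_exp_high.
exists (psC c^-1 * v); rewrite mulrCA mulrA.
have -> : psC c^-1 * y = 1 - g by rewrite opprB addrC subrK.
apply: psP => m; rewrite cf_mul.
transitivity (cf m ((1 - g) * \sum_(j < (mdeg m).+1) g ^+ j)).
  rewrite cf_mul; apply: eq_big_seq => a; rewrite mem_below => am; congr (_ * _).
  by apply: vE; rewrite ltnS -{2}(msubK am) mdeg_add leq_addl.
rewrite -opprB mulNr -subrX1 opprB raddfB /= (cf_exp_high g0) ?subr0 //.
Qed.

(** The powers [1, x_i, ..., x_i^N] are dependent modulo the ideal, since the quotient is spanned by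
    [N] elements. A dependence is a polynomial in [x_i] inside the ideal, equal to its lowest power
    of [x_i] times a unit. *)
Lemma power_in_ideal f i : fin_quot f -> exists N, ideal f (psX k i N).
Proof.
move=> [N [g gE]].
have idealE x : in_ideal f x -> ideal f x.
  move=> [a aE]; exists a; apply: psP => m; rewrite raddf_sum; exact: aE.
have /choice[c cE] : forall l : 'I_N.+1, exists c : 'I_N -> k,
    ideal f (psX k i l - \sum_j psC (c j) * g j).
  move=> l; have [c /idealE cE] := gE (psX k i l); exists c.
  suff -> : psX k i l - \sum_j psC (c j) * g j = (fun m => psX k i l m - \sum_j c j * g j m) by [].
  apply: psP => m; rewrite raddfB raddf_sum /=; congr (_ - _).
  by apply: eq_bigr => j _; rewrite cf_psC_mul.
pose C := \matrix_(l, j) c l j : 'M[k]_(N.+1, N).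
have /rowV0Pn[u /sub_kermxP uC un0] : kermx C != 0.
  rewrite kermx_eq0 /row_free; apply: contraTneq (rank_leq_col C) => ->.
  by rewrite ltnn.
have iP : ideal f (\sum_l psC (u 0 l) * psX k i l).
  have -> : \sum_l psC (u 0 l) * psX k i l =
      \sum_l psC (u 0 l) * (psX k i l - \sum_j psC (c l j) * g j).
    under [RHS]eq_bigr => l _ do rewrite mulrBr mulr_sumr.
    rewrite sumrB [X in _ - X]exchange_big [X in _ - X]big1 ?subr0 //= => j _.
    under eq_bigr => l _ do rewrite mulrA -rmorphM.
    rewrite -mulr_suml -rmorph_sum /=.
    have -> : \sum_l u 0 l * c l j = (u *m C) 0 j.
      by rewrite mxE; apply: eq_bigr => l _; rewrite mxE.
    by rewrite uC mxE rmorph0 mul0r.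
  by apply: ideal_sum => l _; apply: idealM.
have [l0 ul0 lmin] : exists2 l0 : 'I_N.+1, u 0 l0 != 0 & forall l : 'I_N.+1, u 0 l != 0 -> (l0 <= l)%N.
  have [l ul] : exists l, u 0 l != 0 by apply/existsP; apply: contraNT un0 => /existsPn u0;
    apply/eqP/rowP => l; rewrite mxE; apply/eqP; move: (u0 l); rewrite negbK.
  by case: (@arg_minnP _ l (fun l : 'I_N.+1 => u 0 l != 0) (fun l : 'I_N.+1 => l : nat) ul) => l0; exists l0.
exists l0; pose y : ps := \sum_(l < N.+1) psC (u 0 l) * psX k i (l - l0).
have yE : \sum_l psC (u 0 l) * psX k i l = psX k i l0 * y.
  rewrite mulr_sumr; apply: eq_bigr => l _; have [->|/lmin ll] := eqVneq (u 0 l) 0.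
    by rewrite rmorph0 !mul0r mulr0.
  by rewrite mulrCA -psX_D subnKC.
have /ps_invertible[v yv] : cf (mono0 n) y != 0.
  rewrite raddf_sum (bigD1 l0) //= big1 ?addr0 => [|l ll0].
    by rewrite cf_psC_mul subnn psX0 -mon0 cf_mon eqxx mulr1.
  rewrite cf_psC_mul psX_mon cf_mon; have [->|/lmin ll] := eqVneq (u 0 l) 0; first by rewrite mul0r.
  case: eqP => [/(congr1 (fun z : mono n => z i))|_]; last by rewrite mulr0.
  rewrite !ffunE eqxx => /esym/eqP; rewrite subn_eq0 => ll'.
  by case/eqP: ll0; apply/val_inj/eqP; rewrite eqn_leq ll ll'.
by rewrite -[psX k i l0]mulr1 -yv mulrA -yE mulrC; apply: idealM.
Qed.

Lemma power_relation_exists f : fin_quot f -> exists N A, power_relation f N A.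
Proof.
move=> fq; have /choice[e eE] : forall i, exists e, ideal f (psX k i e).
  by move=> i; apply: power_in_ideal.
pose N := (\sum_i e i).+1.
have /choice[c cE] : forall i, exists c : 'I_n -> ps, psX k i N = \sum_j c j * f j.
  move=> i; have -> : N = ((N - e i) + e i)%N.
    by rewrite subnK // /N ltnW // ltnS (bigD1 i) //= leq_addr.
  by rewrite psX_D; apply: idealM.
exists N, (\matrix_(i, j) c i j); split=> // i; rewrite cE.
by apply: eq_bigr => j _; rewrite mxE.
Qed.

Lemma psdetE A : psdet A = \det A.
Proof.
apply: psP => m; rewrite /psdet /determinant raddf_sum /=; apply: eq_bigr => sg _.
by rewrite psC_sign cf_psC_mul.
Qed.

Lemma res_validE f N A : res_valid f N A <-> power_relation f N A.
Proof.
split=> [[N0 hA]|[N0 hA]]; split=> // i.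
  by apply: psP => m; rewrite raddf_sum; apply: hA.
by move=> m; rewrite hA -/(cf m _) raddf_sum.
Qed.

(** By [residue_unique] the predicate under [epsilon] is satisfiable, and its instance at [N] and
    [A] fixes the chosen value. *)
Lemma Res_residue f h N A : fin_quot f -> power_relation f N A -> Res f h = residue h N A.
Proof.
move=> fq vA.
have P0 : exists v, (exists N A, res_valid f N A) /\
    forall N A, res_valid f N A -> v = res_value h N A.
  exists (residue h N A); split=> [|N' A' /res_validE vA'].
    by exists N, A; apply/res_validE.
  by rewrite (residue_unique h vA vA') /res_value psdetE.
have [_ /(_ N A)] := epsilon_spec (inhabits 0) _ P0.
by rewrite /Res => -> //; [rewrite /res_value psdetE | apply/res_validE].
Qed.

End Residue.

(** * The finite rank model of a complex over power series *)

Section Box.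
Variables (k : fieldType) (n N : nat).
Local Notation ps := (ps k n).
Hypothesis N0 : (0 < N)%N.

Definition ffun_mono (a : {ffun 'I_n -> 'I_N}) : mono n := [ffun i => nat_of_ord (a i)].

(** Monomials in the variables of [l] only, with exponents below [N]; the recursion adds one
    variable at a time, as the trace computation does. *)
Fixpoint box (l : seq 'I_n) : seq (mono n) :=
  if l is i :: l' then [seq madd b (monoX i c) | c <- iota 0 N, b <- box l'] else [:: mono0 n].

Lemma mem_box l (b : mono n) : uniq l ->
  (b \in box l) = [forall i, b i < if i \in l then N else 1]%N.
Proof.
elim: l b => [|i l IH] b /=.
  move=> _; rewrite inE; apply/eqP/forallP => [-> i|b0]; first by rewrite ffunE.
  by apply: monoP => i; rewrite ffunE; apply/eqP; rewrite -leqn0 -ltnS; apply: b0.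
move=> /andP[il ul]; apply/allpairsP/forallP => [[[c b'] /= [cN]]|bN].
  rewrite IH // mem_iota in cN * => /forallP bN -> j; have := bN j.
  rewrite !ffunE inE; case: eqP => [->|_] /=; rewrite ?addn0 //.
  by rewrite (negPf il) ltnS leqn0 => /eqP ->.
exists (b i, msub b (monoX i (b i))) => /=; split.
- by rewrite mem_iota; have := bN i; rewrite mem_head.
- rewrite IH //; apply/forallP => j; have := bN j; rewrite !ffunE inE.
  by case: eqP => [->|_] /=; rewrite ?subn0 // subnn (negPf il).
by rewrite maddC msubK // mle_monoX.
Qed.

Lemma box0 l i (b : mono n) : uniq l -> b \in box l -> i \notin l -> b i = 0%N.
Proof.
move=> ul; rewrite mem_box // => /forallP/(_ i) + /negPf il.
by rewrite il ltnS leqn0 => /eqP.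
Qed.

Lemma box_uniq l : uniq l -> uniq (box l).
Proof.
elim: l => //= i l IH /andP[il ul]; apply: allpairs_uniq; rewrite ?iota_uniq ?IH //.
move=> [c b] [c' b'] /allpairsP[[c1 b1] /= [_ b1l [-> ->]]] /allpairsP[[c2 b2] /= [_ b2l [-> ->]]] e.
have ec : c1 = c2.
  by have := congr1 (fun z : mono n => z i) e; rewrite !ffunE eqxx !(box0 ul _ il).
rewrite -ec in e *; congr pair.
by have := congr1 (fun z => msub z (monoX i c1)) e; rewrite /= !maddK.
Qed.

Lemma ffun_mono_inj : injective ffun_mono.
Proof.
move=> a b e; apply/ffunP => i; apply/val_inj.
by have := congr1 (fun z : mono n => z i) e; rewrite !ffunE.
Qed.

Lemma sum_box (H : mono n -> k) :
  \sum_(a : {ffun 'I_n -> 'I_N}) H (ffun_mono a) = \sum_(b <- box (enum 'I_n)) H b.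
Proof.
rewrite -big_enum -(big_map ffun_mono xpredT H); apply: perm_big; apply: uniq_perm.
- by rewrite map_inj_uniq ?enum_uniq //; apply: ffun_mono_inj.
- by apply: box_uniq; apply: enum_uniq.
move=> b; rewrite mem_box ?enum_uniq //; apply/mapP/forallP => [[a _ ->] i|bN].
  by rewrite mem_enum ffunE ltn_ord.
have bN' i : (b i < N)%N by have := bN i; rewrite mem_enum.
exists [ffun i => Ordinal (bN' i)]; first by rewrite mem_enum.
by apply: monoP => i; rewrite !ffunE.
Qed.

(** Subtracting [x_i^N S_i g] for each variable in turn changes [f] by an element of the ideal and
    deletes every coefficient outside the box. *)
Lemma low_coefs_ideal (f : ps) : (forall a, cf (ffun_mono a) f = 0) ->
  ideal (fun i => psX k i N) f.
Proof.
move=> f0; pose tr i (g : ps) := g - psX k i N * shift i N g.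
have cf_tr i g (m : mono n) : cf m (tr i g) = if (m i < N)%N then cf m g else 0.
  rewrite /tr raddfB /= cf_psX_mul; case: leqP => mi; last by rewrite subr0.
  by rewrite cf_shift maddC msubK ?subrr // mle_monoX.
have trs l : ideal (fun i => psX k i N) (f - foldr tr f l) /\
    (forall m, cf m (foldr tr f l) = if all (fun i => m i < N)%N l then cf m f else 0).
  elim: l => [|i l [IH1 IH2]] /=; first by split=> //; rewrite subrr; apply: ideal0.
  split=> [|m]; last by rewrite cf_tr IH2; case: ifP.
  rewrite /tr opprB addrCA addrC; apply: idealD => //.
  by rewrite mulrC; apply: idealM; apply: (ideal_gen (fun i => psX k i N)).
have [+ F0] := trs (enum 'I_n); rewrite (_ : foldr _ _ _ = 0) ?subr0 //.
apply: psP => m; rewrite F0 raddf0 /=; case: ifP => // /allP mN.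
have mN' i : (m i < N)%N by apply: mN; rewrite mem_enum.
rewrite -(f0 [ffun i => Ordinal (mN' i)]); congr (cf _ f).
by apply: monoP => i; rewrite !ffunE.
Qed.

Lemma ideal_low_coefs (f : ps) a : ideal (fun i => psX k i N) f -> cf (ffun_mono a) f = 0.
Proof.
move=> [c ->]; rewrite raddf_sum big1 // => i _ /=; rewrite mulrC cf_psX_mul ffunE.
by rewrite leqNgt ltn_ord.
Qed.

End Box.

(** * The truncated endomorphism and its trace *)

Section Model.
Variables (k : fieldType) (n M N : nat).
Local Notation ps := (ps k n).
Local Notation Z := 'rV[ps]_M.
Local Notation X := (psX k).
Hypothesis N0 : (0 < N)%N.

Definition word (F : 'I_n -> 'M[ps]_M) (J : seq 'I_n) : 'M[ps]_M :=
  foldr (fun j B => F j *m B) 1%:M J.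

Lemma word_cons F j J : word F (j :: J) = F j *m word F J. Proof. by []. Qed.

Lemma word_cat F J J' : word F (J ++ J') = word F J *m word F J'.
Proof. by elim: J => [|j J IH] /=; rewrite ?mul1mx // IH mulmxA. Qed.

Variables (Dm Gm Phi : 'M[ps]_M) (Lam : 'I_n -> 'M[ps]_M) (sg : 'I_M -> k).
Hypothesis DD : Dm *m Dm = 0.
Hypothesis DLam : forall i, Lam i *m Dm + Dm *m Lam i = (X i N)%:M.
Hypothesis DPhi : Phi *m Dm = Dm *m Phi.
Hypothesis GE : Gm = diag_mx (\row_q psC (sg q)).
Hypothesis GD : Gm *m Dm = - (Dm *m Gm).

Let Df : {additive Z -> Z} := mulmxr Dm.
Let sf i : {additive Z -> Z} := *:%R (X i N).
Let Sf i : {additive Z -> Z} := @shiftmx k n i N 1 M.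
Let iof i : {additive Z -> Z} := mulmxr (Lam i).

Local Notation commutators := (comm_ops Df Sf).
Local Notation l0 := (enum 'I_n).

Definition dDm i := map_mx (psdiff i) Dm.

Lemma DfE v : Df v = v *m Dm. Proof. by []. Qed.

Lemma comm_opE i v : comm_op Df Sf i v = comm_shift i N Dm v.
Proof. by []. Qed.

Lemma comm_op_scale i (c : ps) v : free_of i c ->
  comm_op Df Sf i (c *: v) = c *: comm_op Df Sf i v.
Proof.
move=> ci; have shZ w : shiftmx i N (c *: w) = c *: shiftmx i N w :> Z.
  by apply/matrixP => p q; rewrite !mxE shift_free.
by rewrite !comm_opE /comm_shift -scalemxAl !shZ -scalemxAl scalerBr.
Qed.

Lemma comm_ops_scale l (c : ps) v : (forall i, i \in l -> free_of i c) ->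
  commutators l (c *: v) = c *: commutators l v.
Proof.
elim: l v => //= i l IH v cl; rewrite comm_op_scale ?IH // => [j jl|];
  apply: cl; rewrite inE ?jl ?orbT ?eqxx //.
Qed.

Lemma comm_opsX l i v : i \in l -> commutators l (X i N *: v) = 0.
Proof.
move=> il; apply: (@comm_ops_s _ _ _ Df sf Sf _ _ _ l i v il).
- by move=> j w; rewrite !DfE -scalemxAl.
- by move=> j j' w ij; apply/matrixP => p q; rewrite !mxE shift_psX_ne // eq_sym.
- by move=> j w; apply: shiftmx_psX.
Qed.

(** The last letter of [l] acts first and each [iof i] multiplies on the right, hence the reversed
    word. *)
Lemma contractionsE l v : contractions iof l v = v *m word Lam (rev l).
Proof.
elim: l => [|i l IH] /=; first by rewrite mulmx1.
by rewrite rev_cons -cats1 word_cat /= mulmx1 IH mulmxA.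
Qed.

Lemma contractions_scale l c v : contractions iof l (c *: v) = c *: contractions iof l v.
Proof. by rewrite !contractionsE scalemxAl. Qed.

Lemma homotopyZ v : v *m Dm = 0 -> exists h,
  v = (-1) ^+ size l0 *: commutators l0 (contractions iof l0 v) + h *m Dm.
Proof.
move=> vD; apply: (@homotopy_to_commutators _ _ _ Df sf Sf iof) => //; last exact: enum_uniq.
- by move=> w; rewrite !DfE -mulmxA DD mulmx0.
- by move=> i w; rewrite !DfE -scalemxAl.
- by move=> i j w ij; apply/matrixP => p q; rewrite !mxE shift_psX_ne // eq_sym.
- by move=> i j w; rewrite /sf /iof /= -scalemxAl.
- by move=> i w; apply: shiftmx_psX.
- by move=> i w; rewrite /= -!mulmxA -mulmxDr DLam mul_mx_scalar.
Qed.

(* The finite rank endomorphism of [Z] homotopic to [Phi]. *)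
Definition Tz v : Z := (-1) ^+ size l0 *: commutators l0 (contractions iof l0 v) *m Phi.

Lemma Tz_is_zmod : zmod_morphism Tz.
Proof.
move=> u v; rewrite /Tz !contractionsE mulmxBl.
by rewrite (raddfB (commutators l0)) /= scalerBr mulmxBl.
Qed.
HB.instance Definition _ := GRing.isZmodMorphism.Build Z Z Tz Tz_is_zmod.

Lemma TzX i v : Tz (X i N *: v) = 0.
Proof.
by rewrite /Tz contractions_scale comm_opsX ?mem_enum // scaler0 mul0mx.
Qed.

Lemma TzC (c : k) v : Tz (psC c *: v) = psC c *: Tz v.
Proof.
rewrite /Tz contractions_scale comm_ops_scale.
  by rewrite -!scalemxAl !scalerA mulrC.
move=> i _ m; rewrite cf_psC; case: eqP => // ->; by rewrite ffunE.
Qed.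

(** Contractions pass the differential with a sign each, up to multiples of the [x_i^N]. The
    commutators applied afterwards kill these multiples, which makes [Tz] a chain map. *)
Lemma contractions_D l v : exists w : 'I_n -> Z,
  contractions iof l v *m Dm = (-1) ^+ size l *: contractions iof l (v *m Dm) + \sum_i X i N *: w i.
Proof.
elim: l => [|i l [w IH]] /=.
  by exists (fun=> 0); rewrite scale1r big1 ?addr0 // => i _; rewrite scaler0.
exists (fun j => - (w j *m Lam i) + (j == i)%:R *: contractions iof l v).
rewrite -mulmxA.
have -> : Lam i *m Dm = (X i N)%:M - Dm *m Lam i by rewrite -DLam addrK.
rewrite mulmxBr mulmxA IH mulmxDl mul_mx_scalar exprS mulN1r scaleNr -scalemxAl mulmx_suml.
under [X in _ = _ + X]eq_bigr => j _ do rewrite scalerDr scalerN.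
rewrite big_split /= sumrN [X in _ = _ + (_ + X)](bigD1 i) //= eqxx scale1r.
rewrite [X in _ = _ + (_ + (_ + X))]big1 ?addr0 => [|j /negPf ->]; last by rewrite scale0r scaler0.
rewrite opprD addrC -addrA; congr (_ + (- _ + _)).
by apply: eq_bigr => j _; rewrite scalemxAl.
Qed.

Lemma Tz_D v : Tz (v *m Dm) = Tz v *m Dm.
Proof.
have [w cD] := contractions_D l0 v.
have Dcomm u : commutators l0 u *m Dm = (-1) ^+ size l0 *: commutators l0 (u *m Dm).
  rewrite -!DfE; apply: D_comm_ops => x.
  by rewrite !DfE -mulmxA DD mulmx0.
rewrite /Tz -mulmxA DPhi mulmxA; congr (_ *m Phi); rewrite -scalemxAl Dcomm cD (raddfD (commutators l0)) /=.
rewrite (raddf_sum (commutators l0)) /= [X in _ + X]big1 ?addr0 => [|i _]; last first.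
  by apply: comm_opsX; rewrite mem_enum.
rewrite -(signr_odd ps (size l0)); case: (odd _); rewrite ?expr1 ?expr0 ?scale1r //.
by rewrite !scaleN1r (raddfN (commutators l0)) /= ?opprK.
Qed.

Local Notation K := ({ffun 'I_n -> 'I_N} * 'I_M)%type.
Local Notation C := 'rV[k]_#|{: K}|.

(** The quotient map to [Z/(x_1^N, ..., x_n^N)Z] in the monomial basis; [polyz] is its section by
    polynomials of degree below [N] in each variable. *)
Definition pz (v : Z) : C :=
  \row_x cf (ffun_mono (enum_val x).1) (v 0 (enum_val x).2).

Definition polyz (c : C) : Z :=
  \sum_x (psC (c 0 x) * mon k (ffun_mono (enum_val x).1)) *: delta_mx 0 (enum_val x).2.

Lemma pz_is_zmod : zmod_morphism pz.
Proof. by move=> u v; apply/rowP => x; rewrite !mxE raddfB. Qed.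
HB.instance Definition _ := GRing.isZmodMorphism.Build Z C pz pz_is_zmod.

Lemma polyz_is_zmod : zmod_morphism polyz.
Proof.
move=> u v; rewrite /polyz -sumrB; apply: eq_bigr => x _.
by rewrite !mxE rmorphB mulrBl scalerBl.
Qed.
HB.instance Definition _ := GRing.isZmodMorphism.Build C Z polyz polyz_is_zmod.

Lemma pzC (c : k) v : pz (psC c *: v) = c *: pz v.
Proof. by apply/rowP => x; rewrite !mxE cf_psC_mul. Qed.

Lemma polyzC (c : k) u : polyz (c *: u) = psC c *: polyz u.
Proof.
rewrite /polyz scaler_sumr; apply: eq_bigr => x _.
by rewrite !mxE rmorphM scalerA mulrA.
Qed.

Lemma polyzK c : pz (polyz c) = c.
Proof.
apply/rowP => x; rewrite mxE /polyz summxE raddf_sum (bigD1 x) //= big1 ?addr0.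
  by rewrite !mxE !eqxx mulr1 cf_psC_mul cf_mon eqxx mulr1.
move=> y yx; rewrite !mxE /=; case: eqP => e; last by rewrite mulr0 raddf0.
rewrite mulr1 cf_psC_mul cf_mon; case: eqP => e'; last by rewrite mulr0.
case/eqP: yx; apply: enum_val_inj; rewrite (surjective_pairing (enum_val x)).
by rewrite (surjective_pairing (enum_val y)) e (ffun_mono_inj e').
Qed.

Lemma pz_ker v : pz v = 0 <-> exists w : 'I_n -> Z, v = \sum_i X i N *: w i.
Proof.
split=> [v0|[w ->]]; last first.
  apply/rowP => x; rewrite !mxE summxE; apply: ideal_low_coefs => //.
  by exists (fun i => w i 0 (enum_val x).2); apply: eq_bigr => i _; rewrite mxE mulrC.
have /choice[w wE] : forall q, exists c : 'I_n -> ps, v 0 q = \sum_i c i * X i N.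
  move=> q; apply: low_coefs_ideal => a.
  by have /rowP/(_ (enum_rank (a, q))) := v0; rewrite !mxE enum_rankK.
exists (fun i => \row_q w q i); apply/rowP => q; rewrite wE summxE.
by apply: eq_bigr => i _; rewrite !mxE mulrC.
Qed.

Lemma pz_ker_mul v (B : 'M[ps]_M) : pz v = 0 -> pz (v *m B) = 0.
Proof.
move/pz_ker => [w ->]; apply/pz_ker; exists (fun i => w i *m B).
by rewrite mulmx_suml; apply: eq_bigr => i _; rewrite scalemxAl.
Qed.

Lemma pz_polyz_mul v (B : 'M[ps]_M) : pz (polyz (pz v) *m B) = pz (v *m B).
Proof.
apply/eqP; rewrite -subr_eq0 -(raddfB pz) -mulmxBl; apply/eqP.
by apply: pz_ker_mul; rewrite raddfB /= polyzK subrr.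
Qed.

Lemma Tz_pz v : Tz (polyz (pz v)) = Tz v.
Proof.
apply/eqP; rewrite -subr_eq0 -(raddfB Tz); apply/eqP.
have /pz_ker[w ->] : pz (polyz (pz v) - v) = 0 by rewrite raddfB /= polyzK subrr.
by rewrite (raddf_sum Tz) big1 // => i _ /=; rewrite TzX.
Qed.

(** [polyz] commutes with the differentials only up to multiples of the [x_i^N]. [Tz] kills these,
    so the composite is a chain map. *)
Definition jz : {additive C -> Z} := Tz \o polyz.

Definition matz (F : C -> C) : 'M[k]_#|{: K}| := \matrix_x F (delta_mx 0 x).

Lemma matzE (F : {additive C -> C}) c : (forall (a : k) u, F (a *: u) = a *: F u) ->
  F c = c *m matz F.
Proof.
move=> FZ; rewrite {1}(row_sum_delta c) raddf_sum mulmx_sum_row.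
by apply: eq_bigr => x _; rewrite rowK /= FZ.
Qed.

Definition dz : {additive C -> C} := pz \o mulmxr Dm \o polyz.
Definition tz : {additive C -> C} := pz \o Tz \o polyz.
Definition gz : 'M[k]_#|{: K}| := diag_mx (\row_x sg (enum_val x).2).

Lemma dzE c : c *m matz dz = pz (polyz c *m Dm).
Proof. by rewrite -matzE // => a u; rewrite /= polyzC -scalemxAl pzC. Qed.

Lemma tzE c : c *m matz tz = pz (Tz (polyz c)).
Proof. by rewrite -matzE // => a u; rewrite /= polyzC TzC pzC. Qed.

Lemma pz_dz v : pz v *m matz dz = pz (v *m Dm).
Proof. by rewrite dzE pz_polyz_mul. Qed.

Lemma pz_gz v : pz v *m gz = pz (v *m Gm).
Proof.
apply/rowP => x; rewrite /gz GE !mul_mx_diag !mxE.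
by rewrite [v _ _ * _]mulrC cf_psC_mul mulrC.
Qed.

(** Contractions keep [v] among the multiples of the [x_i^N], so the commutator operator homotopic
    to the identity sends it to zero. Thus [pz] detects cohomology classes, which bounds their
    dimension. *)
Lemma pz_ker_coboundary v : v *m Dm = 0 -> pz v = 0 -> exists h, v = h *m Dm.
Proof.
move=> vD /pz_ker[w vw]; have [h hE] := homotopyZ vD; exists h; rewrite [LHS]hE.
suff -> : commutators l0 (contractions iof l0 v) = 0 by rewrite scaler0 add0r.
rewrite contractionsE vw mulmx_suml (raddf_sum (commutators l0)) /= big1 // => i _.
by rewrite -scalemxAl comm_opsX ?mem_enum.
Qed.

(** A partial trace with commutators left for the variables in [l]. The input monomial [a] and the
    output monomial [m] are separate because a variable already summed adds [N-1] to the output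
    exponent and nothing to the input. *)
Definition local_trace l (Q : 'M[ps]_M) (a m : mono n) : k :=
  \sum_q sg q * cf m ((commutators l (mon k a *: delta_mx 0 q *m Q) *m Phi) 0 q).

Definition out_coef l (m : mono n) q (i : 'I_n) (c : nat) (v : Z) : k :=
  cf (madd m (monoX i c)) ((commutators l v *m Phi) 0 q).

Lemma out_coef_is_zmod l m q i c : zmod_morphism (out_coef l m q i c).
Proof.
by move=> u v; rewrite /out_coef (raddfB (commutators l)) mulmxBl !mxE raddfB.
Qed.
HB.instance Definition _ l m q i c :=
  GRing.isZmodMorphism.Build Z k (out_coef l m q i c) (out_coef_is_zmod l m q i c).

(** The hypothesis [FX] of the one-variable computation; it holds because the commutators for the
    other variables commute with [x_i]. *)
Lemma out_coefX l (m : mono n) q i c d v : i \notin l -> m i = 0%N ->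
  out_coef l m q i c (X i d *: v) = if (d <= c)%N then out_coef l m q i (c - d) v else 0.
Proof.
move=> il mi; rewrite /out_coef comm_ops_scale => [|j jl]; last first.
  by apply: free_psX; apply: contraNneq il => <-.
rewrite -scalemxAl mxE cf_psX_mul !ffunE eqxx mi add0n; case: ifP => // dc.
suff -> : msub (madd m (monoX i c)) (monoX i d) = madd m (monoX i (c - d)) by [].
by apply: monoP => j; rewrite !ffunE; case: eqP => [->|_]; rewrite ?subn0 // mi.
Qed.

Lemma local_trace_step l Q a (m : mono n) i : i \notin l -> m i = 0%N ->
  \sum_(c < N) local_trace (i :: l) Q (madd a (monoX i c)) (madd m (monoX i c)) =
  - local_trace l (Q *m dDm i) a (madd m (monoX i N.-1)).
Proof.
move=> il mi; rewrite /local_trace exchange_big -sumrN /=; apply: eq_bigr => q _.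
rewrite -mulr_sumr -mulrN; congr (_ * _).
have := @trace_comm_shift k n M i N (out_coef l m q i)
  (fun c d v => out_coefX q c d v il mi) Dm (mon k a *: delta_mx 0 q *m Q) N0.
rewrite /= /out_coef /dDm mulmxA => <-; apply: eq_bigr => c _.
by rewrite comm_opE monD mulrC -scalerA -scalemxAl psX_mon.
Qed.

Definition top_mono l : mono n := foldr (fun i t => madd (monoX i N.-1) t) (mono0 n) l.

Lemma local_trace_box l Q a (m : mono n) : uniq l -> (forall i, i \in l -> m i = 0%N) ->
  \sum_(b <- box N l) local_trace l Q (madd a b) (madd m b) =
  (-1) ^+ size l * local_trace [::] (Q *m word dDm l) a (madd m (top_mono l)).
Proof.
elim: l Q a m => [|i l IH] Q a m /=; first by rewrite big_seq1 !madd0 mulmx1 mul1r.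
move=> /andP[il ul] ml; rewrite big_allpairs_dep exchange_big /=.
transitivity (\sum_(b <- box N l) - local_trace l (Q *m dDm i) (madd a b)
    (madd (madd m (monoX i N.-1)) b)).
  apply: eq_big_seq => b bl; have bi := box0 ul bl il.
  have -> : madd (madd m (monoX i N.-1)) b = madd (madd m b) (monoX i N.-1).
    by rewrite -!maddA (maddC b).
  rewrite -local_trace_step //; last by rewrite ffunE ml ?mem_head // bi.
  rewrite -{1}(subn0 N) -/(index_iota 0 N) big_mkord.
  by apply: eq_bigr => c _; rewrite !maddA.
rewrite sumrN IH // => [|j jl].
  by rewrite exprS mulN1r mulNr maddA mulmxA.
rewrite !ffunE ml ?inE ?jl ?orbT //; case: eqP => // ji.
by rewrite -ji jl in il.
Qed.

Lemma top_mono_enum : top_mono l0 = monoc n N.-1.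
Proof.
apply: monoP => j; rewrite ffunE.
have -> : top_mono l0 j = (\sum_(i <- l0) monoX i N.-1 j)%N.
  elim: l0 => [|i l IH] /=; first by rewrite big_nil ffunE.
  by rewrite big_cons ffunE IH.
rewrite big_enum (bigD1 j) //= ffunE eqxx big1 ?addn0 // => i /negPf ij.
by rewrite ffunE eq_sym ij.
Qed.

Lemma trace_tz : \tr (matz tz *m gz) =
  cf (monoc n N.-1) (\tr (word Lam (rev l0) *m word dDm l0 *m Phi *m Gm)).
Proof.
transitivity ((-1) ^+ size l0 *
    \sum_(b <- box N l0) local_trace l0 (word Lam (rev l0)) b b).
  rewrite -sum_box mulr_sumr /mxtrace.
  under [RHS]eq_bigr => a _ do rewrite /local_trace mulr_sumr.
  rewrite pair_bigA /= [RHS](reindex (@enum_val _ (mem {: K}))) /=; last first.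
    exists enum_rank => x _; rewrite ?enum_valK ?enum_rankK //.
  apply: eq_bigr => x _.
  rewrite mul_mx_diag !mxE /= [RHS]mulrCA mulrC; congr (_ * _).
  have -> : polyz (delta_mx 0 x) =
      mon k (ffun_mono (enum_val x).1) *: delta_mx 0 (enum_val x).2.
    rewrite /polyz (bigD1 x) //= big1 ?addr0 => [|y yx].
      by rewrite mxE !eqxx rmorph1 mul1r.
    by rewrite mxE (negPf yx) andbF rmorph0 mul0r scale0r.
  rewrite /Tz contractionsE -cf_psC_mul -psC_sign mulr_sumr; congr (cf _ _).
  by apply: eq_bigr => j _; rewrite [in LHS]mxE mulrA.
rewrite (eq_bigr (fun b => local_trace l0 (word Lam (rev l0)) (madd (mono0 n) b)
  (madd (mono0 n) b))); last by move=> b _; rewrite maddC madd0.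
rewrite local_trace_box ?enum_uniq // => [|i _]; last by rewrite ffunE.
(* The sign built into [Tz] meets the equal sign from the [n] one-variable traces. *)
rewrite mulrA -exprD addnn -mul2n exprM sqrrN expr1n expr1n mul1r maddC madd0 top_mono_enum.
rewrite /local_trace /mxtrace raddf_sum /=; apply: eq_bigr => q _.
set W := _ *m word _ _.
have -> : (W *m Phi *m Gm) q q = psC (sg q) * (W *m Phi) q q.
  by rewrite GE mul_mx_diag [LHS]mxE [X in _ * X = _]mxE mulrC.
by rewrite cf_psC_mul mon0 scale1r -mulmxA -rowE mxE.
Qed.

Section Homology.
Variables (NN : nat) (z : 'I_NN -> Z) (eps : 'I_NN -> k) (Mx : 'M[k]_NN).
Local Notation comb := (comb (@psC k n)).
Hypothesis Dz : forall l, z l *m Dm = 0.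
Hypothesis zG : forall l, z l *m Gm = psC (eps l) *: z l.
Hypothesis span : forall v, v *m Dm = 0 -> exists c u, v = comb c z + u *m Dm.
Hypothesis indep : forall c u, comb c z = u *m Dm -> forall l, c l = 0.
Hypothesis act : forall l, exists u, z l *m Phi = comb (Mx l) z + u *m Dm.

Lemma supertrace_finite : \tr (matz tz *m gz) = \sum_l eps l * Mx l l.
Proof.
apply: (@supertrace_homology k ps (@psC k n) Z _ pz jz _ _ Df (matz dz) (matz tz) gz _ _ _ _ _ _ _ z) => //.
- exact: pzC.
- by move=> c u; rewrite /= polyzC TzC.
- by move=> c v; rewrite !DfE scalemxAl.
- by move=> c; rewrite dzE /= -Tz_D Tz_pz.
- by move=> v; rewrite pz_dz.
- by move=> c; rewrite tzE.
- apply/row_matrixP => i; rewrite !rowE mulmx0 mulmxA !dzE pz_polyz_mul -mulmxA DD mulmx0.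
  exact: raddf0.
- apply/row_matrixP => i; rewrite !rowE mulmxN !mulmxA -[delta_mx _ _]polyzK.
  by rewrite pz_gz !pz_dz pz_gz -!mulmxA GD mulmxN (raddfN pz).
- by move=> l; rewrite pz_gz zG pzC.
move=> l; have [u uE] := act l; have [h hE] := homotopyZ (Dz l).
(* [h] comes from the homotopy at the cocycle [z l]; passing from [z l *m Phi] to [Tz (z l)] costs
   the boundary of [h *m Phi]. *)
exists (u - h *m Phi); rewrite /= Tz_pz /Tz.
have -> : (-1) ^+ size l0 *: commutators l0 (contractions iof l0 (z l)) = z l - h *m Dm.
  by rewrite [X in X - _]hE addrK.
by rewrite !mulmxBl uE -!mulmxA -DPhi addrA.
Qed.

Lemma supertrace_residue : \sum_l eps l * Mx l l =
  cf (monoc n N.-1) (\tr (word Lam (rev l0) *m word dDm l0 *m Phi *m Gm)).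
Proof. by rewrite -supertrace_finite trace_tz. Qed.

End Homology.

End Model.

(** * Traces of words *)

Section WordTrace.
Variables (k : fieldType) (n M : nat).
Local Notation ps := (ps k n).
Variables (d : 'M[ps]_M) (mu : 'I_n -> 'M[ps]_M) (f : 'I_n -> ps).
Hypothesis dmu : forall i, mu i *m d + d *m mu i = (f i)%:M.

(** Substituting [f j = mu j d + d mu j] makes the deletion sum telescope, leaving [d] at the two
    ends of the word. The matrix [U] collects the letters already passed. *)
Lemma kdiff_word (U B : 'M[ps]_M) J :
  kdiff f (fun L => \tr (U *m word mu L *m B)) J =
  \tr (U *m (d *m word mu J - (-1) ^+ size J *: (word mu J *m d)) *m B).
Proof.
rewrite /kdiff; elim: J U => [|j J IH] U /=.
  by rewrite scale1r mulmx1 mul1mx subrr mulmx0 mul0mx mxtrace0.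
rewrite (@eq_delta _ _ _ _ (fun L => \tr (U *m mu j *m word mu L *m B))); last first.
  by move=> L _; rewrite !mulmxA.
have -> : f j * \tr (U *m word mu J *m B) = \tr (U *m ((f j)%:M *m word mu J) *m B).
  by rewrite mul_scalar_mx -scalemxAr -scalemxAl mxtraceZ.
rewrite IH -(mulmxA U (mu j)) -raddfB -mulmxBl -mulmxBr; congr (\tr (U *m _ *m B)).
have -> : d *m (mu j *m word mu J) = (f j)%:M *m word mu J - mu j *m (d *m word mu J).
  by rewrite -dmu mulmxDl -!mulmxA addrC addKr.
rewrite mulmxBr opprB [LHS]addrA addrAC; congr (_ + _).
by rewrite exprS mulN1r scaleNr opprK -mulmxA [RHS]scalemxAr.
Qed.

Lemma word_anticomm (w : 'I_n -> 'M[ps]_M) J :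
  (forall i, w i *m d = - (d *m w i)) -> word w J *m d = (-1) ^+ size J *: (d *m word w J).
Proof.
move=> wd; elim: J => [|j J IH] /=; first by rewrite mul1mx mulmx1 scale1r.
by rewrite -(mulmxA (w j)) IH -scalemxAr (mulmxA (w j)) wd mulNmx -mulmxA exprS mulN1r scaleNr scalerN.
Qed.

Definition word_trace (p : nat) (w : 'M[ps]_M) : cochain k n :=
  fun J => if size J == p then \tr (word mu J *m w) else 0.

Lemma word_trace_supported p w : supported p (word_trace p w).
Proof. by move=> J /negPf sJ; rewrite /word_trace sJ. Qed.

(** Cyclicity of the trace identifies the two end terms of [kdiff_word], and the sign rule for [w]
    makes them cancel. *)
Lemma word_trace_closed p w : d *m w = (-1) ^+ p.+1 *: (w *m d) ->
  kdiff f (word_trace p w) = 0.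
Proof.
move=> dw; apply/funext => J; have [sJ|sJ] := eqVneq (size J) p.+1; last first.
  transitivity (delta (fun j x => f j * x) (0 : cochain k n) J).
    apply: eq_delta => L sL; rewrite /word_trace ifN //.
    by apply: contraNneq sJ => <-; rewrite sL.
  by rewrite -/(kdiff f 0 J) raddf0.
transitivity (kdiff f (fun L => \tr (1%:M *m word mu L *m w)) J).
  apply: eq_delta => L sL; rewrite /word_trace mul1mx.
  by move: sL; rewrite sJ => -[->]; rewrite eqxx.
rewrite kdiff_word mul1mx mulmxBl -scalemxAl -(mulmxA (word mu J)) dw sJ -scalemxAr scalerA.
by rewrite -exprMn mulrNN mul1r expr1n scale1r raddfB /= -mulmxA mxtrace_mulC -mulmxA subrr.
Qed.

End WordTrace.

Section Alternation.
Variables (k : fieldType) (n : nat) (f : 'I_n -> ps k n) (g : cochain k n).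
Hypothesis galt : forall w1 i j w2, ideal f (g (w1 ++ i :: j :: w2) + g (w1 ++ j :: i :: w2)).

(** Move [i] past its neighbour, exchange it with [j] by induction, and move [j] back: three sign
    changes. *)
Lemma swap_ideal w1 i w2 j w3 :
  ideal f (g (w1 ++ i :: w2 ++ j :: w3) + g (w1 ++ j :: w2 ++ i :: w3)).
Proof.
elim: w2 w1 => [|a w2 IH] w1 /=; first exact: galt.
have e1 := galt w1 i a (w2 ++ j :: w3); have e3 := galt w1 j a (w2 ++ i :: w3).
have := IH (rcons w1 a); rewrite !cat_rcons => e2.
have := idealB (idealD e1 e3) e2; congr (ideal f _).
set x1 := g _; set x2 := g _; set x3 := g _; set x4 := g _.
by rewrite addrACA addrK.
Qed.

Lemma tperm_ideal_split (h : 'I_n -> 'I_n) x y p1 p2 p3 :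
  uniq (p1 ++ x :: p2 ++ y :: p3) ->
  ideal f (g (map (h \o tperm x y) (p1 ++ x :: p2 ++ y :: p3))
           + g (map h (p1 ++ x :: p2 ++ y :: p3))).
Proof.
have tpE w : x \notin w -> y \notin w -> map (h \o tperm x y) w = map h w.
  move=> xw yw; apply/eq_in_map => a aw /=; rewrite tpermD //.
    by apply: contraNneq xw => ->.
  by apply: contraNneq yw => ->.
have /perm_uniq -> : perm_eq (p1 ++ x :: p2 ++ y :: p3) (x :: y :: p1 ++ p2 ++ p3).
  rewrite -(cat1s x (_ ++ _)) -(cat1s y p3) perm_catCA /= perm_cons catA.
  by rewrite -(cat1s y p3) perm_catCA /= catA.
rewrite !cons_uniq inE !mem_cat !negb_or -!andbA.
case/and5P=> xy xp1 xp2 xp3 /and4P[yp1 yp2 yp3 _].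
rewrite !map_cat /= !map_cat /= tpermL tpermR !tpE // addrC; exact: swap_ideal.
Qed.

Lemma tperm_ideal (h : 'I_n -> 'I_n) x y : x != y ->
  ideal f (g (map (h \o tperm x y) (enum 'I_n)) + g (map h (enum 'I_n))).
Proof.
move=> xy; have ue := enum_uniq 'I_n; have : x \in enum 'I_n by rewrite mem_enum.
have : y \in enum 'I_n by rewrite mem_enum.
move=> ye xe; case/splitPr: xe ye ue => p1 p2; rewrite mem_cat inE eq_sym (negPf xy) /=.
case/orP => /splitPr[p3 p4]; last exact: tperm_ideal_split.
by rewrite -catA tpermC; apply: tperm_ideal_split.
Qed.

Lemma perm_ideal (sigma : 'S_n) (h : 'I_n -> 'I_n) :
  ideal f (g (map (h \o sigma) (enum 'I_n)) - (-1) ^+ sigma * g (map h (enum 'I_n))).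
Proof.
have [ts -> dts] := prod_tpermP sigma; elim: ts dts h => [|t ts IH] /= => [_ h|/andP[dt dts] h].
  rewrite big_nil odd_perm1 expr0 mul1r (eq_map (g := h)) ?subrr; first exact: ideal0.
  by move=> i /=; rewrite perm1.
rewrite big_cons; set sg := (\prod_(_ <- _) _)%g.
have -> : map (h \o (tperm t.1 t.2 * sg)%g) (enum 'I_n)
    = map ((h \o sg) \o tperm t.1 t.2) (enum 'I_n).
  by apply: eq_map => i /=; rewrite permM.
have := idealB (tperm_ideal (h \o sg) dt) (IH dts h); congr (ideal f _).
rewrite odd_permM odd_tperm dt signr_addb expr1 mulN1r mulNr opprK opprB.
by rewrite addrACA subrr addr0.
Qed.

End Alternation.

(** * From words in the contractions to the determinant *)

Section Antisymmetrisation.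
Variables (k : fieldType) (n M N : nat) (f : 'I_n -> ps k n) (A : 'M[ps k n]_n).
Local Notation ps := (ps k n).
Local Notation e := (enum 'I_n).
Hypothesis char0 : [pchar k] =i pred0.
Hypothesis fA : power_relation f N A.
Variables (d w : 'M[ps]_M) (lam : 'I_n -> 'M[ps]_M).
Hypothesis dlam : forall i, lam i *m d + d *m lam i = (f i)%:M.
Hypothesis dw : d *m w = (-1) ^+ n.+1 *: (w *m d).

Let Lam i := \sum_j A i j *: lam j.

Lemma dLam i : Lam i *m d + d *m Lam i = (psX k i N)%:M.
Proof.
rewrite mulmx_suml mulmx_sumr -big_split /=; have [_ ->] := fA.
rewrite raddf_sum; apply: eq_bigr => j _.
by rewrite -scalemxAl -scalemxAr -scalerDr dlam /= scale_scalar_mx.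
Qed.

(** Serves twice: for [lam] modulo the ideal of the [f i], and for [Lam] modulo that of the
    [x_i^N]. *)
Lemma alternating_words (mu : 'I_n -> 'M[ps]_M) (h : 'I_n -> ps) (B : 'M[ps]_n) L :
    (forall i, mu i *m d + d *m mu i = (h i)%:M) ->
    (forall i, psX k i L = \sum_j B i j * h j) ->
  forall w1 i j w2, let g := fun J => word_trace mu n w (rev J) in
  ideal h (g (w1 ++ i :: j :: w2) + g (w1 ++ j :: i :: w2)).
Proof.
move=> dmu hB w1 i j w2 /=.
have revE a b : rev (w1 ++ a :: b :: w2) = rev w2 ++ b :: a :: rev w1.
  by rewrite rev_cat !rev_cons -!cats1 -!catA.
rewrite !revE; apply: (koszul_top hB (g := word_trace mu n w)); first exact: word_trace_supported.
exact: word_trace_closed.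
Qed.

Lemma rev_word_expand m (I : m.-tuple 'I_n) :
  word Lam (rev I) = \sum_(J : m.-tuple 'I_n)
    (\prod_(i < m) A (tnth I i) (tnth J i)) *: word lam (rev J).
Proof.
elim: m I => [|m IH] I.
  rewrite tuple0 (bigD1 [tuple]) //= big_ord0 scale1r [X in _ + X]big1 ?addr0 // => J.
  by rewrite tuple0.
case/tupleP: I => i I; rewrite (reindex (fun p : 'I_n * m.-tuple 'I_n => cons_tuple p.1 p.2)) /=.
  rewrite -(pair_bigA _ (fun j (J : m.-tuple 'I_n) => (\prod_(l < m.+1)
    A (tnth (cons_tuple i I) l) (tnth (cons_tuple j J) l)) *: word lam (rev (j :: J)))) /=.
  rewrite rev_cons -cats1 word_cat IH /= mulmx1 mulmx_sumr; apply: eq_bigr => j _.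
  rewrite mulmx_suml; apply: eq_bigr => J _.
  rewrite big_ord_recl !tnth0 rev_cons -cats1 word_cat /= mulmx1.
  rewrite -scalemxAr -scalemxAl scalerA; congr (_ * _ *: _).
  by apply: eq_bigr => l _; rewrite !tnthS.
exists (fun J => (thead J, behead_tuple J)) => [[j J] _|J _] /=.
  by congr pair; apply: val_inj.
by case/tupleP: J => j J; apply: val_inj.
Qed.

Lemma fact_neq0 : n`!%:R != 0 :> k.
Proof. by have /pcharf0P -> := char0; rewrite -lt0n fact_gt0. Qed.

(** Both sides are multiplied by [n!]. On the left this gives the signed sum over all orders of the
    word in [Lam]; expanding each [Lam i] in the [lam j] yields a sum over words [J] of
    [det (B J) * t J]. A repeated letter makes the determinant vanish. Each of the [n!] arrangements
    contributes the same residue, the sign of its determinant cancelling that of [t]. *)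
Lemma antisymmetrised_trace :
  cf (monoc n N.-1) (\tr (word Lam (rev e) *m w)) = residue (\tr (word lam (rev e) *m w)) N A.
Proof.
have [N0 hA] := fA; pose c (x : ps) := cf (monoc n N.-1) x.
pose F (J : seq 'I_n) := word_trace Lam n w (rev J).
pose t (J : seq 'I_n) := word_trace lam n w (rev J).
(* Words in [Lam] alternate modulo the ideal of the [x_i^N], on which [c] vanishes; the relation
   matrix is the identity here. *)
have Falt (sigma : 'S_n) : c (F (map sigma e)) = (-1) ^+ (odd_perm sigma) * c (F e).
  have := perm_ideal (alternating_words dLam (B := 1%:M) (L := N) _) sigma id.
  rewrite map_id psC_sign => H; apply/eqP; rewrite -subr_eq0 -cf_psC_mul -raddfB; apply/eqP.
  apply: cf_top_ideal => //; apply: H => i.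
  rewrite (bigD1 i) //= big1 ?addr0 => [|j /negPf ji]; rewrite mxE ?eqxx ?mul1r //.
  by rewrite eq_sym ji mul0r.
have talt (sigma : 'S_n) : residue (t (map sigma e)) N A = (-1) ^+ (odd_perm sigma) * residue (t e) N A.
  have := perm_ideal (alternating_words dlam hA) sigma id.
  rewrite map_id psC_sign => /(residue_kills_ideal fA)/eqP; rewrite residueB subr_eq0 => /eqP ->.
  by rewrite /residue -mulrA cf_psC_mul.
have eF : c (F e) = cf (monoc n N.-1) (\tr (word Lam (rev e) *m w)).
  by rewrite /F /word_trace size_rev size_enum_ord eqxx.
have et : t e = \tr (word lam (rev e) *m w).
  by rewrite /t /word_trace size_rev size_enum_ord eqxx.
rewrite -eF -et; apply: (mulfI fact_neq0).
have FE (sigma : 'S_n) : F (map sigma e) =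
    \sum_(J : n.-tuple 'I_n) (\prod_i A (sigma i) (tnth J i)) * t J.
  rewrite /F /word_trace size_rev size_map size_enum_ord eqxx.
  have -> : map sigma e = [tuple sigma i | i < n] by [].
  rewrite rev_word_expand mulmx_suml raddf_sum; apply: eq_bigr => J _ /=.
  rewrite -scalemxAl mxtraceZ /t /word_trace size_rev size_tuple eqxx; congr (_ * _).
  by apply: eq_bigr => i _; rewrite tnth_mktuple.
pose B (J : n.-tuple 'I_n) := \matrix_(i, a) A a (tnth J i).
have sumE : \sum_(sigma : 'S_n) (-1) ^+ sigma * F (map sigma e) = \sum_(J : n.-tuple 'I_n) \det (B J) * t J.
  under eq_bigr => sigma _ do rewrite FE mulr_sumr.
  rewrite exchange_big; apply: eq_bigr => J _ /=; rewrite /determinant mulr_suml.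
  apply: eq_bigr => sigma _; rewrite mulrA; congr (_ * _ * _).
  by apply: eq_bigr => i _; rewrite mxE.
transitivity (c (\sum_(sigma : 'S_n) (-1) ^+ sigma * F (map sigma e))).
  rewrite /c raddf_sum /= (eq_bigr (fun=> c (F e))) => [|sigma _].
    by rewrite sumr_const card_Sn mulr_natl.
  rewrite psC_sign cf_psC_mul; have := Falt sigma; rewrite /c => ->.
  by rewrite signrMK.
rewrite sumE /c raddf_sum /= (bigID (fun J : n.-tuple 'I_n => uniq J)) /=.
rewrite [X in _ + X]big1 ?addr0 => [|J /tuple_uniqP nJ]; last first.
  suff -> : \det (B J) = 0 by rewrite mul0r raddf0.
  have [i [i' [ii' eJ]]] : exists i i', i != i' /\ tnth J i = tnth J i'.
    apply: contrapT => H; apply: nJ => i i' eJ; apply/eqP/negPn/negP => ii'.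
    by apply: H; exists i, i'.
  by apply: (determinant_alternate ii') => a; rewrite !mxE eJ.
rewrite (eq_bigr (fun=> residue (t e) N A)) => [|J /tuple_uniqP uJ].
  rewrite sumr_const -[LHS]mulr_natl; congr (_%:R * _).
  have := card_uniq_tuples n (mem 'I_n); rewrite card_ord ffactnn => <-; rewrite cardsE.
  by apply: eq_card => J; apply/idP/andP => [uJ|[]//]; split=> //; apply/allP.
pose tau : 'S_n := perm uJ.
have Je : map tau e = J.
  by rewrite -[RHS]map_tnth_enum; apply: eq_map => i; rewrite permE.
have detB : \det (B J) = (-1) ^+ (odd_perm tau) * \det A.
  have -> : B J = row_perm tau A^T by apply/matrixP => i a; rewrite !mxE permE.
  by rewrite row_permE det_mulmx det_perm det_tr.
have := talt tau; rewrite Je /residue detB => H.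
by rewrite psC_sign -mulrA cf_psC_mul [_ * t J]mulrC H signrMK.
Qed.

End Antisymmetrisation.

(** * The Hom complex of two matrix factorisations *)

Section Sandwich.
Variables (R : comNzRingType) (s r : nat).
Implicit Types (P : 'M[R]_s) (Q : 'M[R]_r) (f : 'M[R]_(s, r)).

Lemma sandwich_subproof : {F : 'M[R]_s -> 'M[R]_r -> 'M[R]_(s * r) |
  forall f P Q, mxvec f *m F P Q = mxvec (P *m f *m Q)}.
Proof.
exists (fun P Q => lin_mulmx P *m lin_mulmxr Q) => f P Q.
by rewrite mulmxA !mul_vec_lin.
Qed.

(* The matrix of [f |-> P f Q] on the vectorisation of [s x r] matrices; opaque,
   since unification would otherwise unfold the vectorisation. *)
Definition sandwich := sval sandwich_subproof.

Lemma mxvec_sandwich f P Q : mxvec f *m sandwich P Q = mxvec (P *m f *m Q).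
Proof. exact: svalP sandwich_subproof f P Q. Qed.

Lemma mxvec_ext (A B : 'M[R]_(s * r)) : (forall f, mxvec f *m A = mxvec f *m B) -> A = B.
Proof.
move=> AB; apply/row_matrixP => x; rewrite !rowE -[delta_mx 0 x]vec_mxK.
exact: AB.
Qed.

Lemma sandwichM P Q P' Q' : sandwich P Q *m sandwich P' Q' = sandwich (P' *m P) (Q *m Q').
Proof. by apply: mxvec_ext => f; rewrite mulmxA !mxvec_sandwich !mulmxA. Qed.

Lemma sandwichDl P P' Q : sandwich (P + P') Q = sandwich P Q + sandwich P' Q.
Proof. by apply: mxvec_ext => f; rewrite mulmxDr !mxvec_sandwich !mulmxDl raddfD. Qed.

Lemma sandwichZl c P Q : sandwich (c *: P) Q = c *: sandwich P Q.
Proof. by apply: mxvec_ext => f; rewrite -scalemxAr !mxvec_sandwich -!scalemxAl linearZ. Qed.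

Lemma sandwichZr c P Q : sandwich P (c *: Q) = c *: sandwich P Q.
Proof. by apply: mxvec_ext => f; rewrite -scalemxAr !mxvec_sandwich -!scalemxAr linearZ. Qed.

Lemma sandwichNl P Q : sandwich (- P) Q = - sandwich P Q.
Proof. by rewrite -scaleN1r sandwichZl scaleN1r. Qed.

Lemma sandwichNr P Q : sandwich P (- Q) = - sandwich P Q.
Proof. by rewrite -scaleN1r sandwichZr scaleN1r. Qed.

Lemma sandwich1 : sandwich 1%:M 1%:M = 1%:M.
Proof. by apply: mxvec_ext => f; rewrite mxvec_sandwich mul1mx !mulmx1. Qed.

Lemma sandwich0l Q : sandwich 0 Q = 0.
Proof. by apply: mxvec_ext => f; rewrite mxvec_sandwich !mul0mx mulmx0 linear0. Qed.

Lemma sandwich_scalarl c : sandwich c%:M 1%:M = c%:M.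
Proof. by rewrite -[c%:M]scalemx1 sandwichZl sandwich1 !scalemx1. Qed.

Lemma sandwich_scalarr c : sandwich 1%:M c%:M = c%:M.
Proof. by rewrite -[c%:M]scalemx1 sandwichZr sandwich1 !scalemx1. Qed.

Lemma sandwichE P Q i j i' j' :
  sandwich P Q (mxvec_index i j) (mxvec_index i' j') = P i' i * Q j j'.
Proof.
have -> : sandwich P Q (mxvec_index i j) (mxvec_index i' j') =
    (mxvec (delta_mx i j) *m sandwich P Q) 0 (mxvec_index i' j').
  by rewrite mxvec_delta -rowE [RHS]mxE.
rewrite mxvec_sandwich mxvecE mxE (bigD1 j) //= big1 ?addr0 => [|l lj].
  rewrite mxE (bigD1 i) //= big1 ?addr0 ?mxE ?eqxx ?mulr1 // => l li.
  by rewrite mxE (negPf li) mulr0.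
rewrite mxE big1 ?mul0r // => a _.
by rewrite mxE (negPf lj) andbF mulr0.
Qed.

Lemma mxtrace_sandwich P Q : \tr (sandwich P Q) = \tr P * \tr Q.
Proof.
rewrite {1}/mxtrace (reindex (fun x : 'I_s * 'I_r => mxvec_index x.1 x.2)) /=; last first.
  have [g gK Kg] := curry_mxvec_bij s r; exists g => x _.
    by case: x => a b; apply: (gK (a, b)).
  by have := Kg x; case: (g x) => a b /= <-.
rewrite -(pair_bigA _ (fun i j => sandwich P Q (mxvec_index i j) (mxvec_index i j))) /=.
rewrite /mxtrace mulr_suml; apply: eq_bigr => i _.
by rewrite mulr_sumr; apply: eq_bigr => j _; rewrite sandwichE.
Qed.

End Sandwich.

Lemma map_psdiff_mul (k : fieldType) (n a b c : nat) (i : 'I_n)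
    (A : 'M[ps k n]_(a, b)) (B : 'M[ps k n]_(b, c)) :
  map_mx (psdiff i) (A *m B) = map_mx (psdiff i) A *m B + A *m map_mx (psdiff i) B.
Proof.
apply/matrixP => p q; rewrite !mxE raddf_sum -big_split /=.
by apply: eq_bigr => l _; rewrite psdiffM !mxE.
Qed.

Lemma map_psdiff_sandwich (k : fieldType) (n s r : nat) (i : 'I_n)
    (P : 'M[ps k n]_s) (Q : 'M[ps k n]_r) :
  map_mx (psdiff i) (sandwich P Q) =
  sandwich (map_mx (psdiff i) P) Q + sandwich P (map_mx (psdiff i) Q).
Proof.
have mapE m (A : 'M[ps k n]_m) x y : map_mx (psdiff i) A x y = psdiff i (A x y) by rewrite mxE.
have addE m (A B : 'M[ps k n]_m) x y : (A + B) x y = A x y + B x y by rewrite mxE.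
apply/matrixP => x y; case/mxvec_indexP: x => a b; case/mxvec_indexP: y => a' b'.
by rewrite mapE addE !sandwichE psdiffM !mapE.
Qed.

(** * Words in the derivatives of one factorisation *)

Section GradedMatrices.
Variables (k : fieldType) (n r : nat) (g : 'I_r -> bool).
Local Notation ps := (ps k n).

Definition grading : 'M[ps]_r := diag_mx (\row_i psC (sgnb k (g i))).

Lemma grading2 : grading *m grading = 1%:M.
Proof.
rewrite /grading mulmx_diag; apply/matrixP => i j; rewrite !mxE -rmorphM /sgnb.
by rewrite -expr2 sqrr_sign rmorph1.
Qed.

Lemma map_psdiff_grading i : map_mx (psdiff i) grading = 0.
Proof.
by apply/matrixP => a b; rewrite !mxE; case: eqP => _; rewrite ?mulr1n ?mulr0n ?psdiffC ?raddf0.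
Qed.

(** Conjugation by the grading fixes traces and negates [B], so each trace equals its own
    negative. *)
Lemma odd_trace0 (B : 'M[ps]_r) : [pchar k] =i pred0 ->
  grading *m B = - (B *m grading) -> \tr B = 0 /\ \tr (grading *m B) = 0.
Proof.
move=> char0 GB.
have two (x : ps) : x = - x -> x = 0.
  move=> xN; apply: psP => m; apply/eqP.
  have /eqP : cf m (x + x) = 0 by rewrite {1}xN addNr raddf0.
  rewrite raddfD -mulr2n -mulr_natr mulf_eq0 raddf0 /= orbC.
  by have /pcharf0P -> := char0.
split; apply: two.
  rewrite -{1}[B]mul1mx -grading2 -mulmxA GB mulmxN raddfN /= mulmxA mxtrace_mulC.
  by rewrite mulmxA grading2 mul1mx.
by rewrite [X in _ = - X]mxtrace_mulC GB raddfN.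
Qed.

Variables (d : 'M[ps]_r) (W : ps) (t : 'I_n -> ps).
Hypothesis Gd : grading *m d = - (d *m grading).
Hypothesis d2 : d *m d = W%:M.
Local Notation dd i := (map_mx (psdiff i) d).

Lemma dd_anticomm i : dd i *m d + d *m dd i = (psdiff i W)%:M.
Proof.
rewrite -map_psdiff_mul d2; apply/matrixP => a b; rewrite !mxE.
exact: raddfMn.
Qed.

Lemma grading_dd i : grading *m dd i = - (dd i *m grading).
Proof.
have := congr1 (map_mx (psdiff i)) Gd.
by rewrite map_mxN !map_psdiff_mul map_psdiff_grading mul0mx mulmx0 addr0 add0r.
Qed.

Lemma grading_word J : grading *m word (fun i => dd i) J =
  (-1) ^+ size J *: (word (fun i => dd i) J *m grading).
Proof.
elim: J => [|j J IH] /=; first by rewrite mulmx1 mul1mx scale1r.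
rewrite mulmxA grading_dd mulNmx -(mulmxA (dd j) grading) IH -scalemxAr exprS mulN1r scaleNr.
by rewrite mulmxA.
Qed.

(** Words in the [X]-parts of the derivatives of the Hom differential, where every letter carries a
    grading. *)
Definition twisted_word J := word (fun i => grading *m dd i) J.

(** Each grading moved to the left passes all the odd letters before it, [C(n, 2)] exchanges for
    length [n], and the gradings then cancel in pairs. This is the sign of the theorem. *)
Lemma twisted_wordE J : twisted_word J =
  (-1) ^+ 'C(size J, 2) *: ((if odd (size J) then grading else 1%:M) *m word (fun i => dd i) J).
Proof.
elim: J => [|j J IH]; first by rewrite /= scale1r mulmx1.
have -> : twisted_word (j :: J) = grading *m dd j *m twisted_word J by [].
rewrite IH [size (j :: J)]/= binS bin1 exprD -scalerA -scalemxAr.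
congr (_ *: _); rewrite oddS -signr_odd; case: (odd (size J)) => /=.
  by rewrite expr1 scaleN1r mul1mx !mulmxA -(mulmxA grading) -[dd j *m grading]opprK
    -grading_dd mulmxN mulmxA grading2 mul1mx mulNmx.
by rewrite expr0 scale1r mul1mx mulmxA.
Qed.

(** For odd length the gradings cancel and the trace of an odd matrix is left. For even length the
    trace is a value of a closed cochain supported in length below [n], with [w = a G], so
    [koszul_low] applies. *)
Lemma twisted_trace_ideal J (a : 'M[ps]_r) N A : [pchar k] =i pred0 ->
  power_relation t N A -> (forall i, psdiff i W = t i) ->
  a *m d = d *m a -> a *m grading = grading *m a -> (size J < n)%N ->
  ideal t (\tr (twisted_word J *m a *m grading)).
Proof.
move=> char0 [_ tA] tE ad ag Jn; rewrite twisted_wordE -!scalemxAl mxtraceZ; apply: idealM.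
case: ifP => oddJ; last first.
  rewrite mul1mx -mulmxA.
  have -> : \tr (word (fun i => dd i) J *m (a *m grading)) =
      word_trace (fun i => dd i) (size J) (a *m grading) J.
    by rewrite /word_trace eqxx.
  apply: (koszul_low (g := word_trace (fun i => dd i) (size J) (a *m grading)) tA J Jn).
    exact: word_trace_supported.
  apply: (@word_trace_closed _ _ _ d) => [i|]; first by rewrite /= dd_anticomm tE.
  rewrite exprS -signr_odd oddJ mulr1 scaleN1r mulmxA -ad -!mulmxA Gd mulmxN opprK //.
have -> : \tr (grading *m word (fun i => dd i) J *m a *m grading) =
    \tr (word (fun i => dd i) J *m a).
  by rewrite -!mulmxA mxtrace_mulC -!mulmxA grading2 mulmx1.
have [|-> _] := @odd_trace0 (word (fun i => dd i) J *m a) char0; last exact: ideal0.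
by rewrite mulmxA grading_word -signr_odd oddJ expr1 scaleN1r mulNmx -!mulmxA ag.
Qed.

End GradedMatrices.

(** * The Hom complex as a single matrix *)

Section HomDifferential.
Variables (k : fieldType) (n r s : nat) (gX : 'I_r -> bool) (gY : 'I_s -> bool).
Local Notation ps := (ps k n).
Local Notation e := (enum 'I_n).
Variables (W : ps) (dX alpha : 'M[ps]_r) (dY beta : 'M[ps]_s).
Local Notation GX := (grading k n gX).
Local Notation GY := (grading k n gY).
Hypothesis char0 : [pchar k] =i pred0.
Hypotheses (GdX : GX *m dX = - (dX *m GX)) (GdY : GY *m dY = - (dY *m GY)).
Hypotheses (dX2 : dX *m dX = W%:M) (dY2 : dY *m dY = W%:M).
Hypotheses (aG : alpha *m GX = GX *m alpha) (bG : beta *m GY = GY *m beta).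
Hypotheses (ad : alpha *m dX = dX *m alpha) (bd : beta *m dY = dY *m beta).
Local Notation ddX i := (map_mx (psdiff i) dX).
Local Notation ddY i := (map_mx (psdiff i) dY).

(** [G_Y f G_X] equals [(-1)^|f| f], so one matrix serves both parities:
    [f |-> d_Y f - G_Y f G_X d_X]. *)
Definition hom_diff : 'M[ps]_(s * r) := sandwich dY 1%:M - sandwich GY (GX *m dX).
Definition hom_grading : 'M[ps]_(s * r) := sandwich GY GX.
Definition hom_map : 'M[ps]_(s * r) := sandwich beta alpha.
Definition hom_homotopy i : 'M[ps]_(s * r) := sandwich (ddY i) 1%:M.
Definition hom_sign (x : 'I_(s * r)) : k :=
  mxvec (\matrix_(i, j) (sgnb k (gY i) * sgnb k (gX j))) 0 x.

Lemma hom_diff2 : hom_diff *m hom_diff = 0.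
Proof.
rewrite /hom_diff mulmxBl !mulmxBr !sandwichM dY2 grading2 !mulmx1 !mul1mx GdY.
have -> : GX *m dX *m (GX *m dX) = - W%:M.
  by rewrite [X in X *m _]GdX mulNmx -!mulmxA (mulmxA GX GX) grading2 mul1mx dX2.
by rewrite sandwichNl sandwichNr sandwich_scalarl sandwich_scalarr !opprK [X in _ - X]addrC subrr.
Qed.

(** The [X]-part of the differential contributes nothing, since [G_Y] anticommutes with the
    derivative of [d_Y]. *)
Lemma hom_homotopyE i : hom_homotopy i *m hom_diff + hom_diff *m hom_homotopy i = (psdiff i W)%:M.
Proof.
rewrite /hom_diff mulmxBl mulmxBr !sandwichM !mulmx1 !mul1mx (grading_dd GdY i).
rewrite sandwichNl opprK addrACA subrr addr0 -sandwichDl addrC.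
by rewrite (dd_anticomm dY2) sandwich_scalarl.
Qed.

Lemma hom_mapE : hom_map *m hom_diff = hom_diff *m hom_map.
Proof.
by rewrite /hom_diff mulmxBr mulmxBl !sandwichM !mulmx1 !mul1mx bd bG mulmxA aG -!mulmxA ad.
Qed.

Lemma hom_gradingE : hom_grading = diag_mx (\row_x psC (hom_sign x)).
Proof.
apply/matrixP => x y; case/mxvec_indexP: x => a b; case/mxvec_indexP: y => a' b'.
rewrite sandwichE !mxE /hom_sign mxvecE !mxE.
have -> : (mxvec_index a b == mxvec_index a' b') = ((a', b') == (a, b)).
  have [g gK _] := curry_mxvec_bij s r; rewrite eq_sym; apply/eqP/eqP => [H|[-> ->]//].
  have e1 : g (mxvec_index a b) = (a, b) by apply: (gK (a, b)).
  have e2 : g (mxvec_index a' b') = (a', b') by apply: (gK (a', b')).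
  by rewrite -e1 -e2 H.
rewrite xpair_eqE.
by rewrite mulrnAl mulrnAr -mulrnA mulnb rmorphM andbC [b == b']eq_sym; case: (a' =P a) => [->|].
Qed.

Lemma hom_grading_diff : hom_grading *m hom_diff = - (hom_diff *m hom_grading).
Proof.
rewrite /hom_diff mulmxBr mulmxBl !sandwichM !mulmx1 !mul1mx (mulmxA GX GX) !grading2 mul1mx.
rewrite GdX mulNmx -mulmxA grading2 mulmx1 sandwichNr GdY sandwichNl.
by rewrite !opprK opprD opprK.
Qed.

Lemma dDm_hom i : dDm hom_diff i = hom_homotopy i - sandwich GY (GX *m ddX i).
Proof.
rewrite /dDm /hom_diff map_mxB !map_psdiff_sandwich map_psdiff_mul !map_psdiff_grading.
have -> : map_mx (psdiff i) (1%:M : 'M[ps]_r) = 0.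
  apply/matrixP => a b; rewrite !mxE; case: eqP => _; rewrite ?mulr0n ?raddf0 //.
  by rewrite -(rmorph1 (@psC k n)) psdiffC.
have sandwich0r (P : 'M[ps]_s) : sandwich P (0 : 'M[ps]_r) = 0.
  by rewrite -(scale0r (0 : 'M[ps]_r)) sandwichZr scale0r.
by rewrite sandwich0r sandwich0l mul0mx !add0r addr0.
Qed.

Lemma dDm_anticomm i : dDm hom_diff i *m hom_diff = - (hom_diff *m dDm hom_diff i).
Proof.
apply/eqP; rewrite -addr_eq0 -map_psdiff_mul hom_diff2; apply/eqP.
by apply/matrixP => a b; rewrite !mxE raddf0.
Qed.

Definition omega := word (dDm hom_diff) e *m hom_map *m hom_grading.

(** The [n] letters and the grading each change the sign on passing the differential, and [hom_map]
    does not. *)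
Lemma hom_diff_omega : hom_diff *m omega = (-1) ^+ n.+1 *: (omega *m hom_diff).
Proof.
have -> : omega *m hom_diff = - ((-1) ^+ n *: (hom_diff *m omega)).
  have := word_anticomm e dDm_anticomm; rewrite size_enum_ord /omega; set w := word _ _ => wD.
  rewrite -(mulmxA (w *m hom_map)) hom_grading_diff mulmxN (mulmxA (w *m hom_map)).
  by rewrite -(mulmxA w) hom_mapE (mulmxA w) wD -!scalemxAl !(mulmxA hom_diff).
rewrite exprS mulN1r scaleNr scalerN opprK scalerA -exprMn mulrNN mul1r expr1n.
by rewrite scale1r.
Qed.

Lemma word_homotopy J : word hom_homotopy J = sandwich (word (fun i => ddY i) (rev J)) 1%:M.
Proof.
elim: J => [|j J IH] /=; first by rewrite sandwich1.
by rewrite IH rev_cons -cats1 word_cat /= mulmx1 sandwichM mulmx1.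
Qed.

Local Notation gpow p := (if odd p then GY else 1%:M).

(** The leading term takes the [X]-part of every letter. The others are recorded only through their
    shorter [X]-words, which suffices to discard them. *)
Lemma word_dDm_expand l : exists F : seq ('M[ps]_s * seq 'I_n),
  (forall x, x \in F -> size x.2 < size l)%N /\
  word (dDm hom_diff) l =
    sandwich ((-1) ^+ size l *: gpow (size l)) (twisted_word gX dX l)
    + \sum_(x <- F) sandwich x.1 (twisted_word gX dX x.2).
Proof.
elim: l => [|i l [F [Fl IH]]].
  by exists [::]; split=> //; rewrite big_nil addr0 scale1r sandwich1.
(* New lower terms: the old leading term met by a [Y]-letter, and the old lower terms met by a
   [Y]-letter or an [X]-letter. *)
exists (((-1) ^+ size l *: gpow (size l) *m ddY i, l)
  :: [seq (x.1 *m ddY i, x.2) | x <- F] ++ [seq (- (x.1 *m GY), i :: x.2) | x <- F]).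
split=> [x|].
  rewrite inE mem_cat => /or3P[/eqP ->|/mapP[y /Fl yl ->]|/mapP[y /Fl yl ->]] //=.
  by rewrite ltnW.
rewrite word_cons IH dDm_hom mulmxDr mulmxBl !sandwichM big_cons big_cat !big_map /=.
rewrite mulmxBl !mulmx_sumr.
have -> : \sum_(x <- F) hom_homotopy i *m sandwich x.1 (twisted_word gX dX x.2) =
    \sum_(x <- F) sandwich (x.1 *m ddY i) (twisted_word gX dX x.2).
  by apply: eq_bigr => x _; rewrite sandwichM mul1mx.
have -> : \sum_(x <- F) sandwich (- (x.1 *m GY)) (twisted_word gX dX (i :: x.2)) =
    - \sum_(x <- F) sandwich GY (GX *m ddX i) *m sandwich x.1 (twisted_word gX dX x.2).
  by rewrite -sumrN; apply: eq_bigr => x _; rewrite sandwichM sandwichNl.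
rewrite mul1mx addrA [in RHS]addrA [in RHS]addrA; congr (_ + _ + _); rewrite addrC; congr (_ + _).
rewrite -sandwichNl; congr (sandwich _ _); rewrite -scalemxAl exprS mulN1r scaleNr.
by congr (- (_ *: _)); case: (odd _) => /=; rewrite ?grading2 ?mul1mx.
Qed.

Variables (N : nat) (A : 'M[ps]_n).
Hypothesis tA : power_relation (fun i => psdiff i W) N A.

Lemma residue_sign m (x : ps) : residue ((-1) ^+ m * x) N A = (-1) ^+ m * residue x N A.
Proof.
by rewrite psC_sign /residue -mulrA cf_psC_mul.
Qed.

(** A term with fewer than [n] letters from [X] has its [X]-trace in the ideal. For even [n] the
    leading term is, up to the sign, the product of the two supertraces; for odd [n] its [X]-trace
    and the supertrace of [X] both vanish by parity. *)
Lemma residue_hom_trace :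
  residue (\tr (word hom_homotopy (rev e) *m omega)) N A =
  (-1) ^+ 'C(n, 2) * residue (\tr (GX *m (alpha *m word (fun i => ddX i) e))
                            * \tr (GY *m (beta *m word (fun i => ddY i) e))) N A.
Proof.
have [F [Fl FE]] := word_dDm_expand e; rewrite size_enum_ord in Fl FE.
have trE P Q : \tr (word hom_homotopy (rev e) *m (sandwich P Q *m hom_map *m hom_grading)) =
    \tr (GY *m (beta *m (P *m word (fun i => ddY i) e))) * \tr (Q *m alpha *m GX).
  by rewrite word_homotopy revK !sandwichM mul1mx mxtrace_sandwich -!mulmxA.
pose u := \tr (GY *m (beta *m word (fun i => ddY i) e)).
rewrite -residue_sign; apply: (residue_congr tA).
rewrite /omega FE !mulmxDl mulmxDr raddfD /= !mulmx_suml mulmx_sumr raddf_sum /= trE.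
rewrite addrAC; apply: idealD; last first.
  rewrite big_seq; apply: ideal_sum => x xF; rewrite trE; apply: idealM.
  exact: (twisted_trace_ideal GdX dX2 char0 tA (fun=> erefl) ad aG (Fl _ xF)).
rewrite twisted_wordE // size_enum_ord.
rewrite -!scalemxAl !mxtraceZ.
case oddn: (odd n); last first.
  rewrite -signr_odd oddn expr0 scale1r mul1mx mul1mx -mulmxA.
  rewrite (mxtrace_mulC (word _ _)) aG -mulmxA [_ * \tr (GY *m _)]mulrC.
  by rewrite mulrCA subrr; apply: ideal0.
have w0 : GX *m (alpha *m word (fun i => ddX i) e) = - (alpha *m word (fun i => ddX i) e *m GX).
  by rewrite mulmxA -aG -mulmxA grading_word // size_enum_ord -signr_odd oddn expr1 scaleN1r mulmxN mulmxA.
have [w1 w2] := odd_trace0 char0 w0; rewrite w2 mul0r mulr0 subr0.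
set w := word _ _ in w1 *.
have -> : \tr (GX *m w *m alpha *m GX) = 0.
  by rewrite -!mulmxA mxtrace_mulC -!mulmxA grading2 mulmx1 mxtrace_mulC.
by rewrite !mulr0; apply: ideal0.
Qed.

End HomDifferential.

(** * From the encoding of the statement to matrices over the ring of series *)

Section Translation.
Variables (k : fieldType) (n : nat).
Local Notation ps := (ps k n).

Lemma cf_fun (F : mono n -> k) (x : ps) : (forall m, F m = cf m x) -> (F : ps) = x.
Proof. by move=> Fx; apply: psP. Qed.

Lemma mxmulE a b c (A : 'M[ps]_(a, b)) (B : 'M[ps]_(b, c)) : mxmul A B = A *m B.
Proof.
apply/matrixP => i j; rewrite !mxE; apply: cf_fun => m.
by rewrite raddf_sum.
Qed.

Lemma mxsubE a b (A B : 'M[ps]_(a, b)) : Defs.mxsub A B = A - B.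
Proof. by apply/matrixP => i j; rewrite !mxE; apply: cf_fun => m; rewrite raddfB. Qed.

Lemma lincombE a b N c (z : 'I_N -> 'M[ps]_(a, b)) :
  lincomb c z = \sum_l psC (c l) *: z l.
Proof.
apply/matrixP => i j; rewrite summxE mxE; apply: cf_fun => m; rewrite raddf_sum.
by apply: eq_bigr => l _; rewrite mxE /= cf_psC_mul.
Qed.

Lemma mxdiffE a b i (A : 'M[ps]_(a, b)) : Defs.mxdiff i A = map_mx (psdiff i) A.
Proof. by apply/matrixP => p q; rewrite !mxE. Qed.

Lemma matrix_eqP a b (A B : 'M[ps]_(a, b)) : A = B <-> forall i j m, A i j m = B i j m.
Proof. by split=> [->|AB] //; apply/matrixP => i j; apply: psP => m; apply: AB. Qed.

Lemma pstrE r (g : 'I_r -> bool) (A : 'M[ps]_r) : pstr g A = \tr (grading k n g *m A).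
Proof.
apply: cf_fun => m; rewrite raddf_sum; apply: eq_bigr => i _ /=.
by rewrite mul_diag_mx !mxE cf_psC_mul.
Qed.

Lemma KLprodE r (a d : 'M[ps]_r) :
  KLprod a d = a *m word (fun i => map_mx (psdiff i) d) (enum 'I_n).
Proof.
rewrite /KLprod; elim: (enum 'I_n) a => [|i l IH] a /=; first by rewrite mulmx1.
by rewrite IH mxmulE mxdiffE mulmxA.
Qed.

Hypothesis char0 : [pchar k] =i pred0.

Lemma two_neq0 : 2%:R != 0 :> k.
Proof. by have /pcharf0P -> := char0. Qed.

(** The gradings multiply the entry at [i], [j] by the sign of its degree; an entry of the wrong
    degree equals its own negative and vanishes because [2] is invertible. *)
Lemma homogE r s (gX : 'I_r -> bool) (gY : 'I_s -> bool) p (f : 'M[ps]_(s, r)) :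
  homog gX gY p f <-> grading k n gY *m f *m grading k n gX = psC (sgnb k p) *: f.
Proof.
have E i j m : (grading k n gY *m f *m grading k n gX) i j m =
    sgnb k (gY i (+) gX j) * f i j m.
  rewrite -/(cf m _) mul_diag_mx mul_mx_diag !mxE mulrC cf_psC_mul cf_psC_mul mulrA.
  by rewrite /sgnb -signr_addb addbC.
split=> [fp|fp i j m ijp].
  apply/matrix_eqP => i j m; rewrite E mxE -/(cf m (_ * _)) cf_psC_mul.
  by have [->|ne] := eqVneq (gY i (+) gX j) p; rewrite /cf ?(fp _ _ _ ne) ?mulr0.
have := congr1 (fun B : 'M[ps]_(s, r) => cf m (B i j)) fp.
rewrite -/(cf m _) /cf E mxE -/(cf m (_ * _)) cf_psC_mul => /eqP.
have -> : sgnb k (gY i (+) gX j) = - sgnb k p.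
  have -> : gY i (+) gX j = ~~ p by move: ijp; case: (_ (+) _); case: (p).
  by rewrite /sgnb; case: (p); rewrite ?expr0 ?expr1 ?opprK.
rewrite mulNr eq_sym -addr_eq0 -mulr2n -mulr_natl !mulf_eq0 (negPf two_neq0) signr_eq0 /=.
by move/eqP.
Qed.

End Translation.

Section HomComplexVectors.
Variables (k : fieldType) (n r s : nat) (gX : 'I_r -> bool) (gY : 'I_s -> bool).
Local Notation ps := (ps k n).
Local Notation V := 'rV[ps]_(s * r).
Variables (W : ps) (dX : 'M[ps]_r) (dY : 'M[ps]_s).
Hypothesis char0 : [pchar k] =i pred0.
Local Notation D := (hom_diff gX gY dX dY).
Local Notation G := (hom_grading k n gX gY).
Local Notation sgn p := (psC (sgnb k p) : ps).
Hypothesis GD : G *m D = - (D *m G).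

Lemma DhomE p f : Dhom dX dY p f = dY *m f - sgn p *: (f *m dX).
Proof.
apply/matrix_eqP => i j m; rewrite mxE -!mxmulE !mxE -[RHS]/(cf m _) raddfB /=.
by rewrite cf_psC_mul.
Qed.

Lemma mxvec_Dhom p f : homog gX gY p f -> mxvec (Dhom dX dY p f) = mxvec f *m D.
Proof.
move/homogE => /(_ char0) fp; rewrite DhomE mulmxBr !mxvec_sandwich mulmx1 raddfB /=.
by rewrite mulmxA fp -scalemxAl.
Qed.

Lemma homog_mxvec p f : homog gX gY p f <-> mxvec f *m G = sgn p *: mxvec f.
Proof.
rewrite homogE // /hom_grading mxvec_sandwich -linearZ /=; split=> [->|] //.
exact: (can_inj mxvecK).
Qed.

Lemma cocycleE p f : cocycle gX gY dX dY p f <->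
  mxvec f *m G = sgn p *: mxvec f /\ mxvec f *m D = 0.
Proof.
split=> [[fp Df]|[/homog_mxvec fp Df]].
  split; first exact/homog_mxvec.
  rewrite -(mxvec_Dhom fp) -[RHS](linear0 mxvec); congr mxvec.
  by apply/matrix_eqP => i j m; rewrite Df mxE.
split=> // i j m; have /matrix_eqP -> : Dhom dX dY p f = 0; last by rewrite mxE.
by apply: (can_inj mxvecK); rewrite (mxvec_Dhom fp) Df linear0.
Qed.

Lemma hom_grading2 : G *m G = 1%:M.
Proof. by rewrite /hom_grading sandwichM !grading2 sandwich1. Qed.

Lemma sgn2 p : sgn p * sgn p = 1.
Proof. by rewrite -rmorphM /sgnb -expr2 sqrr_sign rmorph1. Qed.

Lemma sgnN p : sgn (~~ p) = - sgn p.
Proof. by rewrite -rmorphN /sgnb; case: p; rewrite ?expr0 ?expr1 ?opprK. Qed.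

(** The projection onto degree [p]; the trace argument works with inhomogeneous cocycles, the
    statement with homogeneous ones. *)
Definition parity_part p (u : V) : V := psC 2%:R^-1 *: (u + sgn p *: (u *m G)).

Lemma parity_part_homog p u : parity_part p u *m G = sgn p *: parity_part p u.
Proof.
rewrite /parity_part -scalemxAl mulmxDl -scalemxAl -mulmxA hom_grading2 mulmx1.
rewrite [RHS]scalerA [sgn p * _]mulrC -[RHS]scalerA; congr (_ *: _).
by rewrite scalerDr scalerA sgn2 scale1r addrC.
Qed.

Lemma half_twice (u : V) : psC 2%:R^-1 *: (u + u) = u.
Proof.
have half2 : psC 2%:R^-1 * (1 + 1) = 1 :> ps.
  by rewrite -(rmorph1 (@psC k n)) -rmorphD -rmorphM mulVf // two_neq0.
by rewrite -[u in LHS]scale1r -scalerDl scalerA half2 scale1r.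
Qed.

Lemma parity_part_id p u : u *m G = sgn p *: u -> parity_part p u = u.
Proof. by move=> uG; rewrite /parity_part uG scalerA sgn2 scale1r half_twice. Qed.

Lemma parity_part_other p u : u *m G = sgn (~~ p) *: u -> parity_part p u = 0.
Proof.
by move=> uG; rewrite /parity_part uG sgnN scalerA mulrN sgn2 scaleN1r subrr scaler0.
Qed.

Lemma parity_partD p u v : parity_part p (u + v) = parity_part p u + parity_part p v.
Proof. by rewrite /parity_part -scalerDr; congr (_ *: _); rewrite mulmxDl scalerDr addrACA. Qed.

Lemma parity_part_diff p u : parity_part p (u *m D) = parity_part (~~ p) u *m D.
Proof.
rewrite /parity_part -scalemxAl mulmxDl -scalemxAl -!mulmxA GD sgnN mulmxN.
by rewrite scaleNr scalerN opprK.
Qed.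

Lemma parity_part_sum u : parity_part false u + parity_part true u = u.
Proof.
rewrite /parity_part -scalerDr addrACA -scalerDl (sgnN false) subrr scale0r addr0.
exact: half_twice.
Qed.

(** A primitive of any kind suffices, since its component of parity [~~ p] is again a primitive of
    the homogeneous [f]. *)
Lemma coboundaryE p f : coboundary gX gY dX dY p f <->
  mxvec f *m G = sgn p *: mxvec f /\ exists u, mxvec f = u *m D.
Proof.
split=> [[g [gp fE]]|[fp [u fE]]].
  have fg : mxvec f = mxvec g *m D.
    by rewrite -(mxvec_Dhom gp); congr mxvec; apply/matrix_eqP.
  split; last by exists (mxvec g).
  move/homog_mxvec in gp; rewrite fg -mulmxA -[D *m G]opprK -GD mulmxN mulmxA gp.
  by rewrite sgnN -!scalemxAl scaleNr opprK.
exists (vec_mx (parity_part (~~ p) u)).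
have gp : homog gX gY (~~ p) (vec_mx (parity_part (~~ p) u)).
  by apply/homog_mxvec; rewrite vec_mxK parity_part_homog.
split=> //; apply/matrix_eqP; apply: (can_inj mxvecK).
by rewrite (mxvec_Dhom gp) vec_mxK -parity_part_diff -fE parity_part_id.
Qed.

End HomComplexVectors.

Theorem theorem11p3 (k : fieldType) (n : nat) (W : ps k n)
    (r s : nat) (gX : 'I_r -> bool) (gY : 'I_s -> bool)
    (dX : 'M[ps k n]_r) (dY : 'M[ps k n]_s)
    (alpha : 'M[ps k n]_r) (beta : 'M[ps k n]_s) :
  [pchar k] =i pred0 ->
  is_poly W -> in_msq W -> fin_quot (fun i => psdiff i W) ->
  is_mf gX W dX -> is_mf gY W dY ->
  is_mf_morph gX dX alpha -> is_mf_morph gY dY beta ->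
  let phi := fun f : 'M[ps k n]_(s, r) => mxmul (mxmul beta f) alpha in
  [/\ forall p f, cocycle gX gY dX dY p f -> cocycle gX gY dX dY p (phi f),
      forall p f, coboundary gX gY dX dY p f -> coboundary gX gY dX dY p (phi f),
      exists N (z : 'I_N -> 'M[ps k n]_(s, r)), Hbasis gX gY dX dY false z,
      exists N (z : 'I_N -> 'M[ps k n]_(s, r)), Hbasis gX gY dX dY true z
    & forall (N0 : nat) (z0 : 'I_N0 -> 'M[ps k n]_(s, r)) (M0 : 'M[k]_N0)
             (N1 : nat) (z1 : 'I_N1 -> 'M[ps k n]_(s, r)) (M1 : 'M[k]_N1),
        Hbasis gX gY dX dY false z0 -> Hrep gX gY dX dY phi false z0 M0 ->
        Hbasis gX gY dX dY true z1 -> Hrep gX gY dX dY phi true z1 M1 ->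
        \tr M0 - \tr M1 =
          (-1) ^+ 'C(n, 2) *
          Res (fun i => psdiff i W)
              (psmul (pstr gX (KLprod alpha dX)) (pstr gY (KLprod beta dY)))].
Proof.
move=> char0 _ _ fq [dXodd dX2] [dYodd dY2] [aeven ad] [beven bd] phi.
have mfE m (g : 'I_m -> bool) (d : 'M[ps k n]_m) : homog g g true d ->
    grading k n g *m d = - (d *m grading k n g).
  move/homogE => /(_ char0); rewrite /sgnb expr1 rmorphN1 scaleN1r => e.
  by rewrite -[d in RHS]opprK -e mulNmx -!mulmxA grading2 mulmx1 opprK.
have evenE m (g : 'I_m -> bool) (d : 'M[ps k n]_m) : homog g g false d ->
    d *m grading k n g = grading k n g *m d.
  move/homogE => /(_ char0); rewrite /sgnb expr0 rmorph1 scale1r => e.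
  by rewrite -[d in RHS]e !mulmxA grading2 mul1mx.
have GdX := mfE _ _ _ dXodd; have GdY := mfE _ _ _ dYodd.
have aG := evenE _ _ _ aeven; have bG := evenE _ _ _ beven.
have sqE m (d : 'M[ps k n]_m) :
    (forall i j t, mxmul d d i j t = (if i == j then W t else 0)) -> d *m d = W%:M.
  by move=> d2; apply/matrix_eqP => i j t; rewrite -mxmulE d2 mxE; case: eqP.
have {}dX2 := sqE _ _ dX2; have {}dY2 := sqE _ _ dY2.
have {}ad : alpha *m dX = dX *m alpha by rewrite -!mxmulE; apply/matrix_eqP.
have {}bd : beta *m dY = dY *m beta by rewrite -!mxmulE; apply/matrix_eqP.
pose D := hom_diff gX gY dX dY; pose G := hom_grading k n gX gY.
pose Phi := hom_map alpha beta.
have DD : D *m D = 0 by apply: hom_diff2 dX2 dY2.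
have GD : G *m D = - (D *m G) by apply: hom_grading_diff.
have DPhi : Phi *m D = D *m Phi by apply: hom_mapE.
have GPhi : Phi *m G = G *m Phi.
  by rewrite /Phi /G /hom_map /hom_grading !sandwichM bG aG.
have phiE f : mxvec (phi f) = mxvec f *m Phi by rewrite /Phi /hom_map mxvec_sandwich /phi !mxmulE.
have [N [A tA]] := power_relation_exists fq; have [N0 _] := tA.
pose Lam i := \sum_j A i j *: hom_homotopy r dY j.
have lamE i := hom_homotopyE gX dX GdY dY2 i.
have LamE i : Lam i *m D + D *m Lam i = (psX k i N)%:M by exact: (dLam tA lamE).
have cocE p f : cocycle gX gY dX dY p f <->
    mxvec f *m G = psC (sgnb k p) *: mxvec f /\ mxvec f *m D = 0 by apply: cocycleE.
have cobE p f : coboundary gX gY dX dY p f <->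
    mxvec f *m G = psC (sgnb k p) *: mxvec f /\ exists u, mxvec f = u *m D by apply: coboundaryE.
have vec_comb m c (z : 'I_m -> 'rV[ps k n]_(s * r)) :
    vec_mx (comb (@psC k n) c z) = lincomb c (fun l => vec_mx (z l)).
  by rewrite lincombE /comb linear_sum; apply: eq_bigr => l _; rewrite linearZ.
have mxvec_lincomb m c (z : 'I_m -> 'M[ps k n]_(s, r)) :
    mxvec (lincomb c z) = comb (@psC k n) c (fun l => mxvec (z l)).
  by rewrite lincombE /comb linear_sum; apply: eq_bigr => l _; rewrite linearZ.
have basis p : exists m (z : 'I_m -> 'M[ps k n]_(s, r)), Hbasis gX gY dX dY p z.
  have [||||| m [z [zZ zspan zind]]] := @basis_exists k _ (@psC k n) 'rV[ps k n]_(s * r) _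
     (pz N) (@pzC k n _ N)
     (fun v => cocycle gX gY dX dY p (vec_mx v))
     (fun v => coboundary gX gY dX dY p (vec_mx v)).
  - move=> u v /cocE[u1 u2] /cocE[v1 v2]; apply/cocE; rewrite !vec_mxK in u1 u2 v1 v2 *.
    by rewrite !mulmxDl u1 u2 v1 v2 addr0 scalerDr.
  - move=> c u /cocE[u1 u2]; apply/cocE; rewrite !vec_mxK in u1 u2 *.
    by rewrite -!scalemxAl u1 u2 scaler0 !scalerA mulrC.
  - move=> c u /cobE[u1 [h hE]]; apply/cobE; rewrite !vec_mxK in u1 hE *.
    split; first by rewrite -!scalemxAl u1 !scalerA mulrC.
    by exists (psC c *: h); rewrite hE scalemxAl.
  - by apply/cocE; rewrite vec_mxK !mul0mx scaler0.
  - move=> u /cocE[u1 u2] pu; apply/cobE; split=> //; rewrite vec_mxK in u1 u2 *.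
    exact: (pz_ker_coboundary DD LamE u2 pu).
  exists m, (fun l => vec_mx (z l)); split=> [l|f fZ|c]; first exact: zZ.
    have [|c cE] := zspan (mxvec f); first by rewrite mxvecK.
    by exists c; rewrite mxsubE -vec_comb -[f]mxvecK -linearB.
  by rewrite -vec_comb; apply: zind.
split; [| | exact: basis | exact: basis |].
- move=> p f /cocE[f1 f2]; apply/cocE; rewrite phiE -!mulmxA.
  by rewrite -/G -/D GPhi DPhi !mulmxA f1 f2 mul0mx -scalemxAl.
- move=> p f /cobE[f1 [u uE]]; apply/cobE; rewrite phiE; split.
    by rewrite -mulmxA -/G GPhi mulmxA f1 -scalemxAl.
  by exists (u *m Phi); rewrite uE -!mulmxA -/D DPhi.
move=> m0 z0 M0 m1 z1 M1 [Z0 span0 ind0] act0 [Z1 span1 ind1] act1.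
have splitl a : split (lshift m1 a : 'I_(m0 + m1)) = inl a by apply: (unsplitK (inl a)).
have splitr b : split (rshift m0 b : 'I_(m0 + m1)) = inr b by apply: (unsplitK (inr b)).
(* The even and odd bases are joined into one basis of total cohomology, with [eps] recording
   parity, so that [tr M0 - tr M1] becomes a single supertrace of a block matrix. *)
pose z (l : 'I_(m0 + m1)) := match split l with inl a => mxvec (z0 a) | inr b => mxvec (z1 b) end.
pose eps (l : 'I_(m0 + m1)) : k := match split l with inl _ => 1 | inr _ => -1 end.
pose Mx := block_mx M0 0 0 M1.
have zl a : z (lshift m1 a) = mxvec (z0 a) by rewrite /z splitl.
have zr b : z (rshift m0 b) = mxvec (z1 b) by rewrite /z splitr.
have combE c : comb (@psC k n) c z = mxvec (lincomb (fun a => c (lshift m1 a)) z0)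
    + mxvec (lincomb (fun b => c (rshift m0 b)) z1).
  rewrite !mxvec_lincomb /comb big_split_ord /=.
  by congr (_ + _); apply: eq_bigr => l _; rewrite ?zl ?zr.
have -> : \tr M0 - \tr M1 = \sum_l eps l * Mx l l.
  rewrite big_split_ord /= /mxtrace -sumrN; congr (_ + _); apply: eq_bigr => l _.
    by rewrite /eps splitl mul1r block_mxEul.
  by rewrite /eps splitr mulN1r block_mxEdr.
have lincombG p m c (y : 'I_m -> 'M[ps k n]_(s, r)) : (forall l, cocycle gX gY dX dY p (y l)) ->
    mxvec (lincomb c y) *m G = psC (sgnb k p) *: mxvec (lincomb c y).
  move=> yZ; rewrite mxvec_lincomb /comb mulmx_suml scaler_sumr; apply: eq_bigr => l _.
  by have /cocE[yG _] := yZ l; rewrite -scalemxAl yG !scalerA mulrC.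
have cobB p f g : coboundary gX gY dX dY p (Defs.mxsub f g) -> exists u, mxvec f = mxvec g + u *m D.
  by rewrite mxsubE => /cobE[_ [u uE]]; exists u; rewrite -uE linearB addrC subrK.
have part_closed p v : v *m D = 0 -> cocycle gX gY dX dY p (vec_mx (parity_part gX gY p v)).
  move=> vD; apply/cocE; rewrite vec_mxK; split; first exact: parity_part_homog.
  rewrite -[p]negbK -parity_part_diff // -/D vD.
  by rewrite /parity_part mul0mx !scaler0 addr0 scaler0.
have GE := hom_gradingE k n gX gY.
rewrite (supertrace_residue N0 DD LamE DPhi GE GD (z := z)).
- rewrite -!mulmxA (mulmxA (word (dDm D) _)) -/(omega gX gY dX alpha dY beta).
  rewrite (antisymmetrised_trace char0 tA lamE); last exact: (hom_diff_omega GdX GdY dX2 dY2 aG bG ad bd).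
  rewrite (residue_hom_trace gY dY beta char0 GdX dX2 aG ad tA) (Res_residue _ fq tA); congr (_ * residue _ _ _).
  by rewrite !pstrE !KLprodE.
- move=> l; rewrite /z; case: (split l) => a /=; first by have /cocE[_ ->] := Z0 a.
  by have /cocE[_ ->] := Z1 a.
- move=> l; rewrite /z /eps; case: (split l) => a /=; first by have /cocE[-> _] := Z0 a.
  by have /cocE[-> _] := Z1 a.
(* An arbitrary cocycle is expanded through its two homogeneous parts, each of them a cocycle. *)
- move=> v vD; have [c0 /cobB[u0 e0]] := span0 _ (part_closed false v vD).
  have [c1 /cobB[u1 e1]] := span1 _ (part_closed true v vD).
  exists (fun l => match split l with inl a => c0 a | inr b => c1 b end), (u0 + u1).
  rewrite -[LHS](parity_part_sum gX gY char0) combE.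
  have -> : (fun a => match split (lshift m1 a) with inl a => c0 a | inr b => c1 b end) = c0.
    by apply: funext => a; rewrite splitl.
  have -> : (fun b => match split (rshift m0 b) with inl a => c0 a | inr b => c1 b end) = c1.
    by apply: funext => b; rewrite splitr.
  by rewrite !vec_mxK in e0 e1; rewrite e0 e1 mulmxDl addrACA.
(* Projecting the relation to each parity separates the two bases; the differential exchanges the
   parities of [u]. *)
- move=> c u; rewrite combE => cu.
  set f0 := lincomb _ z0 in cu; set f1 := lincomb _ z1 in cu.
  have f0G : mxvec f0 *m G = psC (sgnb k false) *: mxvec f0 by apply: lincombG.
  have f1G : mxvec f1 *m G = psC (sgnb k true) *: mxvec f1 by apply: lincombG.
  have c0 : forall a, c (lshift m1 a) = 0.
    apply: ind0; apply/cobE; split=> //; exists (parity_part gX gY true u).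
    rewrite -(parity_part_diff GD false) -/D -cu parity_partD.
    by rewrite (parity_part_id char0 f0G) (parity_part_other (p := false) f1G) addr0.
  have c1 : forall b, c (rshift m0 b) = 0.
    apply: ind1; apply/cobE; split=> //; exists (parity_part gX gY false u).
    rewrite -(parity_part_diff GD true) -/D -cu parity_partD.
    by rewrite (parity_part_id char0 f1G) (parity_part_other (p := true) f0G) add0r.
  by move=> l; rewrite -(splitK l); case: (split l) => a /=.
(* The off-diagonal blocks of [Mx] are zero, so each half of the basis is expanded by [M0] or [M1]
   alone. *)
move=> l; rewrite /z; rewrite -{2}(splitK l); case: (split l) => a /=.
- have /cobB[u uE] := act0 a; exists u; rewrite -phiE uE combE; congr (_ + _).
  have -> : (fun a0 => Mx (lshift m1 a) (lshift m1 a0)) = M0 a.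
    by apply: funext => a0; rewrite block_mxEul.
  have -> : (fun b => Mx (lshift m1 a) (rshift m0 b)) = fun=> 0.
    by apply: funext => b; rewrite block_mxEur mxE.
  rewrite [X in _ + X]mxvec_lincomb /comb big1 ?addr0 // => b _.
  by rewrite rmorph0 scale0r.
have /cobB[u uE] := act1 a; exists u; rewrite -phiE uE combE; congr (_ + _).
have -> : (fun b => Mx (rshift m0 a) (rshift m0 b)) = M1 a.
  by apply: funext => b; rewrite block_mxEdr.
have -> : (fun a0 => Mx (rshift m0 a) (lshift m1 a0)) = fun=> 0.
  by apply: funext => a0; rewrite block_mxEdl mxE.
rewrite [X in X + _]mxvec_lincomb /comb big1 ?add0r // => b _.
by rewrite rmorph0 scale0r.
Qed.
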